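(* Let $\mathcal{L}$ be $m$-accretive in $L^1(\Omega)$ and sub-Markovian (if $0\le f\le 1$ then $0\le e^{-t\mathcal L}f\le 1$), and suppose its Green function satisfies $$\mathbb{G}(x,y)\asymp \frac{1}{|x-y|^{N-2s}}\Big( \frac{d(x)^\gamma}{|x-y|^\gamma} \wedge 1 \Big)\Big( \frac{d(y)^\gamma}{|x-y|^\gamma} \wedge 1 \Big)\qquad\text{for a.e. }x,y\in\Omega.$$ Let $u$ be a nonnegative weak dual solution of the Cauchy–Dirichlet problem with initial datum $0\le u_0\in L^1_{\Phi_1}(\Omega)$. Assume that $u_0\le C_0\Phi_1$ for some constant $C_0>0$ and that $$u(T,x)\ge k_{14}\,\Phi_1(x)^\alpha\qquad\text{for a.e. }x\in\Omega,$$ for some constants $k_{14},T,\alpha>0$. Then $\alpha\ge1-\frac{2s}\gamma$. Moreover, if $\sigma_1<1$, then $\alpha>\frac1{m_1}$.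
   Context: Setting. $s\in(0,1]$, $\gamma\in(0,1]$, $N\ge1$ with $N>2s$; $\Omega\subset\mathbb{R}^N$ is a bounded domain with boundary of class at least $C^{1,1}$; $d(x)=\mathrm{dist}(x,\partial\Omega)$; $a\wedge b=\min\{a,b\}$; $f\asymp g$ means that each is bounded by a positive constant times the other. Operator. $\mathcal{L}:\mathrm{dom}(\mathcal L)\subseteq L^1(\Omega)\to L^1(\Omega)$ is linear and densely defined. It has a left inverse $\mathcal L^{-1}:L^1(\Omega)\to L^1(\Omega)$ given by a kernel (Green function) $\mathbb G$: $\mathcal L^{-1}f(x)=\int_\Omega f(y)\mathbb G(x,y)\,dy$ (homogeneous Dirichlet conditions are encoded in $\mathbb G$). $\Phi_1\ge0$ is the bounded first eigenfunction, $\mathcal L\Phi_1=\lambda_1\Phi_1$ with $\lambda_1>0$; under the Green function bounds of the claim it is known that $\Phi_1\asymp d^\gamma$ on $\overline\Omega$. $L^1_{\Phi_1}(\Omega)$ is the space of measurable $f$ with $\|f\|_{L^1_{\Phi_1}(\Omega)}=\int_\Omega|f|\Phi_1\,dx<\infty$. Nonlinearity (standing assumption). $F:\mathbb R\to\mathbb R$ is continuous, non-decreasing, $F(0)=0$, $F\in C^1(\mathbb R\setminus\{0\})$, $F/F'\in \mathrm{Lip}(\mathbb R)$ (with $F/F'$ understood as $0$ where $F=F'=0$ or at $0$), and there are $0<\mu_0\le\mu_1<1$ with $1-\mu_1\le (F/F')'\le 1-\mu_0$ in $\mathbb R$. Put $m_i=\frac1{1-\mu_i}>1$ and $\sigma_i=1\wedge\frac{2sm_i}{\gamma(m_i-1)}$,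 $i=0,1$. Problem. The Cauchy–Dirichlet problem is $\partial_tu+\mathcal L F(u)=0$ in $(0,\infty)\times\Omega$, $u=0$ on the lateral boundary, $u(0,\cdot)=u_0$. Weak dual solutions. $u$ is a weak dual solution if $u\in C([0,\infty):L^1_{\Phi_1}(\Omega))$, $F(u)\in L^1((0,\infty):L^1_{\Phi_1}(\Omega))$, $u(0,\cdot)=u_0\in L^1_{\Phi_1}(\Omega)$, and for every $\psi$ with $\psi/\Phi_1\in C^1_c((0,\infty):L^\infty(\Omega))$ $$\int_0^\infty\int_\Omega \mathcal L^{-1}u\,\partial_t\psi\,dx\,dt=\int_0^\infty\int_\Omega F(u)\,\psi\,dx\,dt.$$ *)

(* Defs.v *)
From HB Require Import structures.
From mathcomp Require Import all_boot all_order all_algebra.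
From mathcomp Require Import all_classical all_reals all_analysis.
From mathcomp Require Import ess_sup_inf.

Set Implicit Arguments.
Unset Strict Implicit.
Unset Printing Implicit Defensive.

Import Order.TTheory GRing.Theory Num.Theory.
Import numFieldNormedType.Exports.

Local Open Scope classical_set_scope.
Local Open Scope ring_scope.

Definition rV_display : measure_display. Proof. exact: default_measure_display. Qed.

Section measurable_rV.
Context (R : realType) (N : nat).

Let coord (i : 'I_N) (x : 'rV[R]_N) : measurableTypeR R := x ord0 i.

Let rV_set0 : g_sigma_preimage coord set0.
Proof. exact: sigma_algebra0. Qed.

Let rV_setC A : g_sigma_preimage coord A -> g_sigma_preimage coord (~` A).
Proof. exact: sigma_algebraC. Qed.

Let rV_bigcup (F : _^nat) : (forall i, g_sigma_preimage coord (F i)) ->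
  g_sigma_preimage coord (\bigcup_i (F i)).
Proof. exact: sigma_algebra_bigcup. Qed.

(* Generated by the coordinates; this is the Borel sigma-algebra of R^N. *)
HB.instance Definition _ := @isMeasurable.Build rV_display
  'rV[R]_N (g_sigma_preimage coord) rV_set0 rV_setC rV_bigcup.

Lemma measurable_coord (i : 'I_N) :
  measurable_fun [set: 'rV[R]_N] (fun x => x ord0 i).
Proof.
move=> _ Y mY; rewrite setTI; apply: sub_sigma_algebra => /=.
rewrite -bigcup_seq/=; exists i => /=; first by rewrite mem_index_enum.
by exists Y => //; rewrite setTI.
Qed.

Lemma measurable_fun_rV d (T : measurableType d) (f : T -> 'rV[R]_N) :
  (forall i, measurable_fun [set: T] (fun t => f t ord0 i)) ->
  measurable_fun [set: T] f.
Proof.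
move=> mf; suff H : g_sigma_preimage (fun i => coord i \o f) `<=` measurable.
  move=> _ A mA; rewrite setTI; apply: H.
  by rewrite g_sigma_preimage_comp; exists A => //; rewrite setTI.
apply: smallest_sub; first exact: sigma_algebra_measurable.
by rewrite -bigcup_seq; apply: bigcup_sub => i _ _ [B mB <-]; exact: mf.
Qed.

End measurable_rV.

Section lebesgue_rV.
Context (R : realType).

Definition cons_rV N (p : R * 'rV[R]_N) : 'rV[R]_N.+1 :=
  \row_j oapp (fun k => p.2 ord0 k) p.1 (unlift ord0 j).

Definition uncons_rV N (x : 'rV[R]_N.+1) : R * 'rV[R]_N :=
  (x ord0 ord0, \row_k x ord0 (lift ord0 k)).

Lemma cons_rVK N : cancel (@cons_rV N) (@uncons_rV N).
Proof.
case=> a v; rewrite /uncons_rV; congr pair; first by rewrite mxE unlift_none.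
by apply/rowP => k; rewrite !mxE liftK.
Qed.

Lemma measurable_cons_rV N : measurable_fun [set: R * 'rV[R]_N] (@cons_rV N).
Proof.
apply: measurable_fun_rV => i.
under eq_fun do rewrite mxE.
case: (unlift ord0 i) => [k|] /=; last exact: measurable_fst.
exact: (measurableT_comp (measurable_coord k) measurable_snd).
Qed.

Lemma measurable_uncons_rV N :
  measurable_fun [set: 'rV[R]_N.+1] (@uncons_rV N).
Proof.
apply: measurable_fun_pair; first exact: measurable_coord.
by apply: measurable_fun_rV => k; under eq_fun do rewrite mxE; exact: measurable_coord.
Qed.

Section step.
Context N (m : {sigma_finite_measure set 'rV[R]_N -> \bar R}).

Definition lebesgue_step : set 'rV[R]_N.+1 -> \bar R :=
  pushforward (lebesgue_measure \x m)%E (@cons_rV N).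

Let mstep : {measure set 'rV[R]_N.+1 -> \bar R} :=
  measure_function_pushforward__canonical__measure_function_Measure
   (lebesgue_measure \x m)%E (@measurable_cons_rV N).

HB.instance Definition _ := Measure.copy lebesgue_step mstep.

Let lebesgue_step_sigma_finite : sigma_finite setT lebesgue_step.
Proof.
have [F FT mF] : sigma_finite setT (lebesgue_measure \x m)%E.
  have /sigma_finiteP[F [TF ndF Foo]] :=
    sigma_finiteT (lebesgue_measure : {sigma_finite_measure set (measurableTypeR R) -> \bar R}).
  have /sigma_finiteP[G [TG ndG Goo]] := sigma_finiteT m.
  exists (fun n => F n `*` G n).
    rewrite -setXTT TF TG predeqE => -[x y]; split.
      move=> [/= [n _ Fnx] [k _ Gky]]; exists (maxn n k) => //; split.
      - by move: x Fnx; exact/subsetPset/ndF/leq_maxl.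
      - by move: y Gky; exact/subsetPset/ndG/leq_maxr.
    by move=> [n _ []/= ? ?]; split; exists n.
  move=> k; have [? ?] := Foo k; have [? ?] := Goo k.
  split; first exact: measurableX.
  by rewrite product_measure1E// lte_mul_pinfty// ge0_fin_numE.
exists (fun i => @uncons_rV N @^-1` F i).
  by rewrite -preimage_bigcup -FT preimage_setT.
move=> i; have [mFi Fioo] := mF i; split.
  by rewrite -[X in measurable X]setTI; exact: measurable_uncons_rV.
rewrite /lebesgue_step /pushforward -comp_preimage.
by rewrite (_ : _ \o _ = id)//; apply/funext => p; exact: cons_rVK.
Qed.

HB.instance Definition _ := Measure_isSigmaFinite.Build _ _ _ lebesgue_step
  lebesgue_step_sigma_finite.

End step.

(* Lebesgue measure on R^N, as the N-fold product of [lebesgue_measure]. *)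
Fixpoint lebesgue_rV N : {sigma_finite_measure set 'rV[R]_N -> \bar R} :=
  if N is n.+1 then lebesgue_step (lebesgue_rV n) else \d_ (0 : 'rV[R]_0).

Lemma lebesgue_rV_box N (A : 'I_N -> set R) :
  (forall i, measurable (A i)) ->
  lebesgue_rV N [set x | forall i, A i (x ord0 i)] =
    (\prod_(i < N) lebesgue_measure (A i))%E.
Proof.
elim: N A => [|N IH] A mA /=.
  by rewrite big_ord0 diracE mem_set// => -[].
have mB : measurable [set x : 'rV[R]_N | forall i, A (lift ord0 i) (x ord0 i)].
  rewrite [X in measurable X](_ : _ = \big[setI/setT]_(i < N)
      ((fun x : 'rV[R]_N => x ord0 i) @^-1` (A (lift ord0 i)))); last first.
    rewrite -bigcap_seq; apply/seteqP; split => x /= h i; first by move=> _; exact: h.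
    by apply: h; rewrite /= mem_index_enum.
  apply: bigsetI_measurable => i _.
  by rewrite -[X in measurable X]setTI; exact: measurable_coord.
rewrite big_ord_recl -IH; last by move=> i; exact: mA.
rewrite -[RHS](product_measure1E lebesgue_measure (lebesgue_rV N) (mA ord0) mB).
rewrite /lebesgue_step /pushforward; congr (product_measure1 _ _ _).
apply/seteqP; split => [[a v] /= h|[a v] [/= ha hv] i]; last first.
  by rewrite mxE; case: unliftP => [j ->|->].
split; first by have := h ord0; rewrite mxE unlift_none.
by move=> i; have := h (lift ord0 i); rewrite mxE liftK.
Qed.

End lebesgue_rV.

Section domains.
Context (R : realType) (N : nat).
Implicit Types (x y p e : 'rV[R]_N) (Omega : set 'rV[R]_N).

Definition dotv x y : R := \sum_(i < N) x ord0 i * y ord0 i.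

(* The library norm on ['rV_N] is the sup norm. *)
Definition enorm x : R := Num.sqrt (dotv x x).

Definition boundary Omega : set 'rV[R]_N := closure Omega `\` interior Omega.

Definition dist_boundary Omega x : R :=
  inf [set enorm (x - y) | y in boundary Omega].

Definition bounded_domain Omega : Prop :=
  [/\ open Omega, connected Omega, Omega !=set0 & bounded_set Omega].

Definition C11 (h : 'rV[R]_N -> R) : Prop :=
  (forall x, differentiable h x) /\
  exists K : R, forall x y v,
    `|'d h x v - 'd h y v| <= K * `|x - y| * `|v|.

(* The projection of x on the hyperplane orthogonal to the unit vector e. *)
Definition tangential e x : 'rV[R]_N := x - dotv x e *: e.

(* Near each boundary point p, in an orthonormal frame centred at p whose last
   axis is e, Omega is the region above the graph of a C^{1,1} function of the
   other N - 1 coordinates. Such a function is represented by h, of which only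
   the restriction to the hyperplane orthogonal to e is used. *)
Definition C11_boundary Omega : Prop :=
  forall p, boundary Omega p ->
  exists (r : R) (e : 'rV[R]_N) (h : 'rV[R]_N -> R),
    [/\ 0 < r, dotv e e = 1, C11 h &
        forall x, enorm (x - p) < r ->
          (Omega x <-> h (tangential e (x - p)) < dotv (x - p) e)].

End domains.

(* Elements of L^1(Omega) and L^1_Phi(Omega) are represented by functions on
   R^N, of which only the restriction to Omega matters, up to null sets. *)

Section spaces.
Context (R : realType) (N : nat) (Omega : set 'rV[R]_N).
Implicit Types (f g Phi : 'rV[R]_N -> R).

Definition ae_in (P : 'rV[R]_N -> Prop) : Prop :=
  \forall x \ae lebesgue_rV R N, Omega x -> P x.

Definition eqae f g : Prop := ae_in (fun x => f x = g x).

Definition L1 f : Prop := (lebesgue_rV R N).-integrable Omega (EFin \o f).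

Definition L1norm f : \bar R :=
  (\int[lebesgue_rV R N]_(x in Omega) `|f x|%:E)%E.

Definition wL1norm Phi f : \bar R :=
  (\int[lebesgue_rV R N]_(x in Omega) (`|f x| * Phi x)%:E)%E.

Definition wL1 Phi f : Prop :=
  measurable_fun Omega f /\ (wL1norm Phi f < +oo)%E.

Definition Linfnorm f : \bar R :=
  ess_sup (lebesgue_rV R N) (fun x => (`|f x| * \1_Omega x)%:E).

(* [phi] is in C^1_c((0,oo) : L^infty(Omega)), with derivative [dphi]. The
   joint measurability selects a representative; every class has one. *)
Definition C1c_Linf (phi dphi : R -> 'rV[R]_N -> R) : Prop :=
  [/\ measurable_fun ((`]0, +oo[ : set R) `*` Omega)
        (fun z => phi z.1 z.2) /\
      measurable_fun ((`]0, +oo[ : set R) `*` Omega)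
        (fun z => dphi z.1 z.2),
      forall t, 0 < t -> (Linfnorm (phi t) < +oo)%E /\ (Linfnorm (dphi t) < +oo)%E,
      forall t, 0 < t ->
        Linfnorm (h^-1 *: (phi (t + h) - phi t) - dphi t) @[h --> 0^'] --> 0%E,
      forall t, 0 < t -> Linfnorm (dphi r - dphi t) @[r --> t] --> 0%E &
      exists a b : R, 0 < a /\
        forall t, 0 < t -> t \notin `[a, b] -> eqae (phi t) 0].

End spaces.

Section operator.
Context (R : realType) (N : nat) (Omega : set 'rV[R]_N).
Notation fn := ('rV[R]_N -> R).
Notation L1 := (L1 Omega).
Notation L1norm := (L1norm Omega).
Notation eqae := (eqae Omega).
Notation ae_in := (ae_in Omega).

(* A linear operator [L] with domain [D], acting on a.e. classes. *)
Record densely_defined_linear (D : set fn) (L : fn -> fn) : Prop := {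
  dom_L1 : forall f, D f -> L1 f ;
  op_L1 : forall f, D f -> L1 (L f) ;
  dom_eqae : forall f (g : fn), D f -> measurable_fun Omega g -> eqae f g ->
    D g /\ eqae (L f) (L g) ;
  dom_lin : forall (a : R) f g, D f -> D g ->
    D (a *: f + g) /\ eqae (L (a *: f + g)) (a *: L f + L g) ;
  dom_dense : forall f (eps : R), L1 f -> 0 < eps ->
    exists2 g, D g & (L1norm (f - g)%R < eps%:E)%E }.

Definition m_accretive (D : set fn) (L : fn -> fn) : Prop :=
  (forall (lam : R) f g, 0 < lam -> D f -> D g ->
     (L1norm (f - g)%R <= L1norm (f - g + lam *: (L f - L g))%R)%E) /\
  (forall (lam : R) g, 0 < lam -> L1 g ->
     exists2 f, D f & eqae (f + lam *: L f) g).

Record C0_semigroup (S : R -> fn -> fn) : Prop := {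
  sg_L1 : forall t f, 0 <= t -> L1 f -> L1 (S t f) ;
  sg_eqae : forall t f g, 0 <= t -> L1 f -> L1 g -> eqae f g ->
    eqae (S t f) (S t g) ;
  sg_lin : forall t (a : R) f g, 0 <= t -> L1 f -> L1 g ->
    eqae (S t (a *: f + g)) (a *: S t f + S t g) ;
  sg_bounded : forall t, 0 <= t -> exists M : R, forall f, L1 f ->
    (L1norm (S t f) <= M%:E * L1norm f)%E ;
  sg_0 : forall f, L1 f -> eqae (S 0 f) f ;
  sg_add : forall t r f, 0 <= t -> 0 <= r -> L1 f ->
    eqae (S (t + r) f) (S t (S r f)) ;
  sg_cont : forall f, L1 f -> L1norm (S t f - f) @[t --> 0^'+] --> 0%E }.

(* [S t] is e^{-tL}: a strongly continuous semigroup with generator [-L]. *)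
Definition generates (D : set fn) (L : fn -> fn) (S : R -> fn -> fn) : Prop :=
  [/\ C0_semigroup S,
      forall f, D f -> L1norm (t^-1 *: (S t f - f) + L f) @[t --> 0^'+] --> 0%E &
      forall f g, L1 f -> L1 g ->
        L1norm (t^-1 *: (S t f - f) - g) @[t --> 0^'+] --> 0%E -> D f].

Definition sub_Markovian (D : set fn) (L : fn -> fn) : Prop :=
  exists2 S, generates D L S &
    forall (t : R) (f : fn), 0 <= t -> measurable_fun Omega f ->
      ae_in (fun x => 0 <= f x <= 1) -> ae_in (fun x => 0 <= S t f x <= 1).

Definition green_op (G : 'rV[R]_N -> 'rV[R]_N -> R) (f : fn) : fn :=
  fun x => \int[lebesgue_rV R N]_(y in Omega) (f y * G x y).

Record green_left_inverse (D : set fn) (L : fn -> fn)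
    (G : 'rV[R]_N -> 'rV[R]_N -> R) : Prop := {
  green_measurable : measurable_fun (Omega `*` Omega) (fun z => G z.1 z.2) ;
  green_integrable : forall f, L1 f ->
    ae_in (fun x => L1 (fun y => f y * G x y)) ;
  green_L1 : forall f, L1 f -> L1 (green_op G f) ;
  green_opK : forall f, D f -> eqae (green_op G (L f)) f }.

Definition is_eigenpair (D : set fn) (L : fn -> fn) (lam : R) (f : fn) : Prop :=
  [/\ D f, ~ eqae f 0 & eqae (L f) (lam *: f)].

Definition first_eigenpair (D : set fn) (L : fn -> fn) (lam1 : R) (Phi1 : fn) :
    Prop :=
  [/\ 0 < lam1, is_eigenpair D L lam1 Phi1,
      forall lam f, is_eigenpair D L lam f -> lam1 <= lam,
      ae_in (fun x => 0 <= Phi1 x) &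
      exists M : R, ae_in (fun x => Phi1 x <= M)].

Definition green_profile (s gamma : R) (x y : 'rV[R]_N) : R :=
  (enorm (x - y) `^ (N%:R - 2 * s))^-1 *
  Num.min (dist_boundary Omega x `^ gamma / enorm (x - y) `^ gamma) 1 *
  Num.min (dist_boundary Omega y `^ gamma / enorm (x - y) `^ gamma) 1.

Definition green_bounds (s gamma : R) (G : 'rV[R]_N -> 'rV[R]_N -> R) : Prop :=
  exists c1 c2 : R, [/\ 0 < c1, 0 < c2 &
    \forall z \ae (lebesgue_rV R N \x lebesgue_rV R N)%E,
      Omega z.1 -> Omega z.2 ->
      c1 * green_profile s gamma z.1 z.2 <= G z.1 z.2 <=
      c2 * green_profile s gamma z.1 z.2].

End operator.

Section nonlinearity.
Context (R : realType).

Definition F_over_dF (F : R -> R) (r : R) : R :=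
  if r == 0 then 0 else F r / F^`()%classic r.

(* A Lipschitz function is only almost everywhere differentiable, so the bounds
   on (F/F')' are required almost everywhere. Since division by 0 is total,
   [F^`() r = 0 -> F r = 0] is what makes F/F' meaningful outside 0. *)
Definition nonlinearity (F : R -> R) (mu0 mu1 : R) : Prop :=
  [/\ continuous F, {homo F : x y / x <= y} & F 0 = 0] /\
  [/\ forall r, r != 0 -> derivable F r 1 /\ {for r, continuous F^`()%classic},
      forall r, r != 0 -> F^`()%classic r = 0 -> F r = 0,
      lipschitz (F_over_dF F) &
      {ae lebesgue_measure, forall r, derivable (F_over_dF F) r 1 /\
        1 - mu1 <= (F_over_dF F)^`()%classic r <= 1 - mu0}] /\
  0 < mu0 <= mu1 /\ mu1 < 1.

Definition m_of (mu : R) : R := (1 - mu)^-1.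

Definition sigma_of (s gamma mu : R) : R :=
  Num.min 1 (2 * s * m_of mu / (gamma * (m_of mu - 1))).

End nonlinearity.

Section wds.
Context (R : realType) (N : nat) (Omega : set 'rV[R]_N).

(* As for test functions, the joint measurability of [u] selects a
   representative of a curve in C([0,oo) : L^1_Phi(Omega)); it makes
   F(u) measurable in (t, x). *)
Record weak_dual_solution (G : 'rV[R]_N -> 'rV[R]_N -> R) (F : R -> R)
    (Phi1 u0 : 'rV[R]_N -> R) (u : R -> 'rV[R]_N -> R) : Prop := {
  wds_measurable :
    measurable_fun ((`[0, +oo[ : set R) `*` Omega) (fun z => u z.1 z.2) ;
  wds_wL1 : forall t, 0 <= t -> wL1 Omega Phi1 (u t) ;
  wds_cont : forall t, 0 <= t ->
    wL1norm Omega Phi1 (u r - u t) @[r --> within `[0, +oo[ (nbhs t)] --> 0%E ;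
  wds_F : (\int[lebesgue_measure]_(t in `]0%R, +oo[)
    wL1norm Omega Phi1 (F \o u t) < +oo)%E ;
  wds_init : wL1 Omega Phi1 u0 /\ eqae Omega (u 0) u0 ;
  wds_eq : forall psi dpsi : R -> 'rV[R]_N -> R,
    C1c_Linf Omega (fun t x => psi t x / Phi1 x) (fun t x => dpsi t x / Phi1 x) ->
    \int[lebesgue_measure]_(t in `]0%R, +oo[)
      \int[lebesgue_rV R N]_(x in Omega) (green_op Omega G (u t) x * dpsi t x) =
    \int[lebesgue_measure]_(t in `]0%R, +oo[)
      \int[lebesgue_rV R N]_(x in Omega) (F (u t x) * psi t x) }.

End wds.

(* Main.v *)
(* Write d for the distance to the boundary and V(t,x) for the integral of
   G(x,y) u(t,y) dy. Testing the equation with theta(t) w(x), where theta >= 0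
   and 0 <= w <= Phi1, shows that the integral of V(t,x) w(x) dx is
   nonincreasing in t, because F(u) >= 0. Since u0 <= C0 Phi1, this gives
   V(T) <= V(0) <= (C0 / lambda1) Phi1 in the weak sense.
   On the other hand u(T) >= k d^(gamma alpha), and integrating
   G(x,y) ~ |x-y|^(2s-N) over the ball of radius d(x)/2 around x gives
   V(T) >= c d^(2s + gamma alpha). As Phi1 <= A d^gamma, letting x approach the
   boundary yields 2s + gamma alpha >= gamma, the first claim; the second one
   follows since sigma_1 < 1 means 1/m_1 < 1 - 2s/gamma.
   The bound Phi1 <= A d^gamma is obtained from Phi1 = lambda1 G Phi1 by a
   bootstrap: Phi1 <= A d^a implies Phi1 <= A' d^b whenever a <= b <= gamma and
   b < a + 2s, so finitely many steps lead from a = 0 to gamma. *)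
Require Import Defs.
From mathcomp Require Import all_boot all_order all_algebra.
From mathcomp Require Import all_classical all_reals all_analysis.
From mathcomp Require Import measurable_realfun ess_sup_inf.
From mathcomp Require Import ring lra.
Import Order.TTheory GRing.Theory Num.Theory.
Import numFieldNormedType.Exports.
Set Implicit Arguments.
Unset Strict Implicit.
Unset Printing Implicit Defensive.
Local Open Scope classical_set_scope.
Local Open Scope ring_scope.

(** * The Euclidean norm and the distance to the boundary *)

(** The inequality between [V(T)] and [V(0)] is only available after integration against a weight,
    so [x] cannot be sent to the boundary pointwise. The weight is [Phi1] cut off to a layer
    [d < eps]: for small [eps] both bounds on the potentials become multiples of the same integral
    [S] of [Phi1^2] over the layer, and [(C + 1) S <= C S] forces [S = 0], although the layer has
    positive measure. Three further points shape the proof. The kernel [G] need not be symmetric,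
    but its bounds are, so exchanging its arguments costs only the factor [c2 / c1]. Real-valued
    integrals take a default value when they diverge, so potentials are first handled as
    extended-real integrals of absolute values, and finiteness of the pairings with [Phi1] brings
    the result back to [green_op]. Finally, a lower bound [Phi1 >= c d^gamma] of Hopf type is needed
    too: it turns [Phi1^alpha] into [d^(gamma alpha)] in the hypothesis on [u(T)], and it makes
    [Phi1] positive almost everywhere. *)

Section enorm.
Context (R : realType) (N : nat).
Implicit Types (x y z : 'rV[R]_N) (r : R).

Lemma dotv_ge0 x : 0 <= dotv x x.
Proof. by apply: sumr_ge0 => i _; rewrite -expr2 sqr_ge0. Qed.

Lemma enorm_ge0 x : 0 <= enorm x.
Proof. exact: sqrtr_ge0. Qed.

Lemma sqr_enorm x : enorm x ^+ 2 = dotv x x.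
Proof. by rewrite sqr_sqrtr// dotv_ge0. Qed.

Lemma dotvDD x y : dotv (x + y) (x + y) = dotv x x + dotv x y *+ 2 + dotv y y.
Proof.
rewrite /dotv -sumrMnl -!big_split/=; apply: eq_bigr => i _.
by rewrite !mxE; ring.
Qed.

Lemma dotvZl (a : R) x y : dotv (a *: x) y = a * dotv x y.
Proof. by rewrite /dotv mulr_sumr; apply: eq_bigr => i _; rewrite mxE mulrA. Qed.

Lemma dotvC x y : dotv x y = dotv y x.
Proof. by apply: eq_bigr => i _; rewrite mulrC. Qed.

Lemma enormZ (a : R) x : enorm (a *: x) = `|a| * enorm x.
Proof.
by rewrite /enorm dotvZl dotvC dotvZl mulrA -expr2 sqrtrM ?sqr_ge0// sqrtr_sqr.
Qed.

Lemma enormN x : enorm (- x) = enorm x.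
Proof. by rewrite -scaleN1r enormZ normrN1 mul1r. Qed.

Lemma enormBC x y : enorm (x - y) = enorm (y - x).
Proof. by rewrite -enormN opprB. Qed.

Lemma coord_le_enorm x i : `|x ord0 i| <= enorm x.
Proof.
rewrite -ler_sqr ?nnegrE ?enorm_ge0// sqr_enorm real_normK ?num_real//.
rewrite /dotv (bigD1 i)//= -expr2 lerDl.
by apply: sumr_ge0 => j _; rewrite -expr2 sqr_ge0.
Qed.

Lemma enorm_eq0 x : enorm x = 0 -> x = 0.
Proof.
move=> x0; apply/rowP => i; rewrite mxE; apply/eqP.
by rewrite -normr_le0 -x0 coord_le_enorm.
Qed.

Lemma dotv_le_enorm x y : dotv x y <= enorm x * enorm y.
Proof.
have [/enorm_eq0->|x0] := eqVneq (enorm x) 0.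
  rewrite -(scale0r 0) dotvZl mul0r scale0r mulr_ge0 ?enorm_ge0//.
have [/enorm_eq0->|y0] := eqVneq (enorm y) 0.
  by rewrite -(scale0r 0) dotvC dotvZl mul0r scale0r mulr_ge0 ?enorm_ge0.
have := dotv_ge0 (enorm y *: x + (- enorm x) *: y).
rewrite dotvDD !dotvZl (dotvC x (_ *: _)) (dotvC y (_ *: _)) (dotvC x) !dotvZl.
rewrite -!sqr_enorm (dotvC y).
have p : 0 < enorm x * enorm y by rewrite mulr_gt0// lt_neqAle enorm_ge0 andbT eq_sym.
move=> h; rewrite -(ler_pM2l p) -subr_ge0.
by move: h; set a := enorm x; set b := enorm y; set c := dotv _ _ => h; lra.
Qed.

Lemma ler_enormD x y : enorm (x + y) <= enorm x + enorm y.
Proof.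
rewrite -ler_sqr ?nnegrE ?addr_ge0 ?enorm_ge0//.
rewrite sqr_enorm dotvDD -!sqr_enorm sqrrD lerD2r lerD2l ler_pMn2r//.
exact: dotv_le_enorm.
Qed.

Lemma enorm_distD z x y : enorm (x - y) <= enorm (x - z) + enorm (z - y).
Proof. by rewrite (le_trans _ (ler_enormD _ _))// addrA subrK. Qed.

Lemma enorm_le x r : 0 <= r -> (forall i, `|x ord0 i| <= r) ->
  enorm x <= N%:R * r.
Proof.
move=> r0 xr; rewrite -ler_sqr ?nnegrE ?enorm_ge0 ?mulr_ge0// sqr_enorm.
apply: (@le_trans _ _ (N%:R * r ^+ 2)).
  rewrite /dotv mulr_natl -[X in _ *+ X]card_ord -sumr_const.
  apply: ler_sum => i _.
  by rewrite -expr2 -(real_normK (num_real _)) ler_sqr ?nnegrE.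
rewrite exprMn ler_wpM2r ?sqr_ge0//.
by rewrite -natrX ler_nat; case: (N) => // n; rewrite expnS leq_pmulr// expn_gt0.
Qed.

(** The topology of row vectors comes from the sup norm; this is the bridge to Euclidean balls. The
    divisor [N%:R + 1] is positive even for [N = 0]. *)
Lemma nbhs_enormP x (A : set 'rV[R]_N) :
  nbhs x A <-> exists2 e : R, 0 < e & forall y, enorm (x - y) < e -> A y.
Proof.
split.
  move/nbhs_ballP => [e /= e0 eA]; exists e => // y xy; apply: eA; split => // i j.
  rewrite ord1; apply: le_lt_trans xy.
  by have := coord_le_enorm (x - y) j; rewrite !mxE.
move=> [e e0 eA]; apply/nbhs_ballP; exists (e / (N%:R + 1)) => /=.
  by rewrite divr_gt0// ltr_wpDl.
move=> y [_ xy]; apply: eA.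
have := @enorm_le (x - y) (e / (N%:R + 1)).
move=> /(_ _ _)/le_lt_trans; apply.
- by rewrite divr_ge0 ?addr_ge0// ltW.
- by move=> i; rewrite !mxE ltW//; exact: xy.
- by rewrite mulrCA gtr_pMr// ltr_pdivrMr ?ltr_wpDl// mul1r ltrDl.
Qed.

End enorm.

Section domain.
Context (R : realType) (N : nat) (Omega : set 'rV[R]_N).
Implicit Types (x y z : 'rV[R]_N) (r : R).
Notation d := (dist_boundary Omega).

Lemma dist_boundary_ge0 x : 0 <= d x.
Proof.
have [B0|/set0P [y By]] := eqVneq (boundary Omega) set0.
  by rewrite /dist_boundary B0 image_set0 inf0.
apply: lb_le_inf; first by exists (enorm (x - y)), y.
by move=> _ [z _ <-]; exact: enorm_ge0.
Qed.

Lemma dist_boundary_le x z : boundary Omega z -> d x <= enorm (x - z).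
Proof.
move=> Bz; apply: ge_inf; last by exists z.
by exists 0 => _ [y _ <-]; exact: enorm_ge0.
Qed.

Hypothesis B0 : boundary Omega !=set0.

Lemma dist_boundary_ltP x r : d x < r -> exists2 z, boundary Omega z & enorm (x - z) < r.
Proof.
move=> dr; have [|_ [z Bz <-] xz] := inf_lt _ dr; last by exists z.
by case: B0 => y By; exists (enorm (x - y)), y.
Qed.

Lemma dist_boundary_lip x y : d x <= enorm (x - y) + d y.
Proof.
rewrite -lerBlDl; apply: lb_le_inf.
  by case: B0 => z Bz; exists (enorm (y - z)), z.
move=> _ [z Bz <-]; rewrite lerBlDl (le_trans (dist_boundary_le x Bz))//.
exact: enorm_distD.
Qed.

End domain.

Section crossing.
Context (R : realType) (N : nat) (Omega : set 'rV[R]_N).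
Hypothesis oO : open Omega.
Implicit Types (x y z : 'rV[R]_N) (r : R).
Notation d := (dist_boundary Omega).

(** The first exit point of the segment works: it is a limit of points of [Omega], and if it were
    interior the segment would stay in [Omega] a little longer. *)
Lemma segment_boundary x y : Omega x -> ~ Omega y ->
  exists2 z, boundary Omega z & enorm (x - z) <= enorm (x - y).
Proof.
move=> Ox nOy.
pose p (t : R) := x + t *: (y - x).
pose S := [set t : R | 0 <= t <= 1 /\ forall r, 0 <= r <= t -> Omega (p r)].
have p0 : p 0 = x by rewrite /p scale0r addr0.
have S0 : S 0.
  split; first by rewrite lexx ler01.
  by move=> r; rewrite -eq_le => /eqP <-; rewrite p0.
have hS : has_sup S by split; [exists 0|exists 1 => t [/andP[]]].
(* [p t0] is the point where the segment first leaves Omega. *)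
pose t0 := sup S.
have t00 : 0 <= t0 by apply: ub_le_sup => //; exact: hS.2.
have t01 : t0 <= 1 by apply: ge_sup; [exists 0|move=> t [/andP[]]].
have pp t r : enorm (p t - p r) = `|t - r| * enorm (y - x).
  by rewrite /p opprD addrACA subrr add0r -scalerBl enormZ.
have below t : 0 <= t < t0 -> Omega (p t).
  move=> /andP[t_ge0 tt0]; have [t1 [_ St1] tt1] := sup_gt (ex_intro _ _ S0) tt0.
  by apply: St1; rewrite t_ge0 ltW.
have C : closure Omega (p t0).
  move=> B /nbhs_enormP[e e0 eB].
  have [t0e|t0e] := eqVneq t0 0.
    exists x; split => //; rewrite -p0 -t0e; apply: eB.
    by rewrite subrr -(scale0r 0) enormZ normr0 mul0r.
  have {}t0e : 0 < t0 by rewrite lt_neqAle eq_sym t0e.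
  pose t := Num.max 0 (t0 - e / (enorm (y - x) + 1)).
  have ey : 0 < enorm (y - x) + 1 by rewrite ltr_wpDl// enorm_ge0.
  have ht : 0 <= t < t0 by rewrite /t le_max lexx/= gt_max t0e gtrDl oppr_lt0 divr_gt0.
  exists (p t); split; first exact: below.
  apply: eB; rewrite pp ger0_norm; last by rewrite subr_ge0; case/andP: ht => _ /ltW.
  apply: (@le_lt_trans _ _ (e / (enorm (y - x) + 1) * enorm (y - x))).
    apply: ler_wpM2r; first exact: enorm_ge0.
    by rewrite lerBlDl -lerBlDr /t le_max lexx orbT.
  by rewrite mulrAC -mulrA gtr_pMr// ltr_pdivrMr// mul1r ltrDl.
exists (p t0); last first.
  rewrite -p0 pp sub0r normrN ger0_norm// p0 (enormBC x).
  by rewrite ler_piMl// enorm_ge0.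
split => // /nbhs_enormP[e e0 eO].
have {}C : Omega (p t0) by apply: eO; rewrite subrr -(scale0r 0) enormZ normr0 mul0r.
have t0n1 : t0 != 1.
  by apply: contra_notN nOy => /eqP t1; move: C; rewrite t1 /p scale1r addrC subrK.
have {}t0n1 : t0 < 1 by rewrite lt_neqAle t0n1.
have ey : 0 < enorm (y - x) + 1 by rewrite ltr_wpDl// enorm_ge0.
(* The first bound keeps [t0 + h] in the unit interval, the second keeps the added piece within
   [e / 2] of [p t0]. *)
pose h := Num.min (1 - t0) (e / 2 / (enorm (y - x) + 1)).
have h0 : 0 < h by rewrite /h lt_min subr_gt0 t0n1 !divr_gt0.
suff : t0 + h <= t0 by rewrite gerDl leNgt h0.
apply: ub_le_sup; first exact: hS.2.
split.
  apply/andP; split; first by rewrite addr_ge0// ltW.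
  by rewrite -lerBrDl /h ge_min lexx.
move=> r /andP[r0 rt]; have [rt0|rt0] := ltP r t0; first by apply: below; rewrite r0.
apply: eO; rewrite pp distrC ger0_norm ?subr_ge0//.
apply: (@le_lt_trans _ _ (e / 2 / (enorm (y - x) + 1) * enorm (y - x))).
  apply: ler_wpM2r; first exact: enorm_ge0.
  by rewrite lerBlDl (le_trans rt)// lerD2l /h ge_min lexx orbT.
apply: (@le_lt_trans _ _ (e / 2)); last by rewrite ltr_pdivrMr// ltr_pMr// ltr1n.
by rewrite mulrAC -mulrA ger_pMr ?divr_gt0// ler_pdivrMr// mul1r lerDl.
Qed.

Lemma dist_boundary_ball x y : Omega x -> enorm (x - y) < d x -> Omega y.
Proof.
move=> Ox xy; apply: contrapT => nOy.
have [z Bz xz] := segment_boundary Ox nOy.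
by have := le_lt_trans (le_trans (dist_boundary_le x Bz) xz) xy; rewrite ltxx.
Qed.

Lemma dist_boundary_gt0 x : boundary Omega !=set0 -> Omega x -> 0 < d x.
Proof.
move=> B0 Ox; have /nbhs_enormP[e e0 eO] : nbhs x Omega by exact: open_nbhs_nbhs.
rewrite ltNge; apply/negP => dx.
have [z [_ nIz] xz] := dist_boundary_ltP B0 (le_lt_trans dx e0).
by apply: nIz; apply: open_nbhs_nbhs; split => //; exact: eO.
Qed.

Lemma dist_boundary_small r : boundary Omega !=set0 -> 0 < r ->
  exists2 x, Omega x & d x < r.
Proof.
move=> [z Bz] r0; have [cz _] := Bz.
have [|x [Ox xz]] := cz [set x | enorm (z - x) < r]; first by apply/nbhs_enormP; exists r.
by exists x => //; rewrite (le_lt_trans (dist_boundary_le x Bz))// enormBC.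
Qed.

End crossing.

Section bounded.
Context (R : realType) (N : nat) (Omega : set 'rV[R]_N).
Hypothesis bO : bounded_domain Omega.
Implicit Types (x y z : 'rV[R]_N) (r : R).
Notation d := (dist_boundary Omega).

Lemma bounded_domain_diam : exists2 M : R, 0 < M &
  forall x y, Omega x -> Omega y -> enorm (x - y) < M.
Proof.
have [_ _ _ [M0 [_ HM]]] := bO.
pose M := Num.max 1 (M0 + 1).
have OM x : Omega x -> enorm x <= N%:R * M.
  have M1 : 0 <= M by rewrite /M le_max ler01.
  move=> Ox; apply: enorm_le => // i.
  apply: (@le_trans _ _ `|x|).
    rewrite [leRHS]mx_normrE.
    exact: (le_bigmax _ (fun ij : 'I_1 * 'I_N => `|x ij.1 ij.2|) (ord0, i)).
  by apply: HM => //; rewrite /M lt_max ltrDl ltr01 orbT.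
exists (N%:R * M + N%:R * M + 1) => [|x y Ox Oy].
  by rewrite ltr_wpDl// addr_ge0// mulr_ge0// /M le_max ler01.
rewrite (@le_lt_trans _ _ (N%:R * M + N%:R * M))// ?ltrDl//.
by rewrite (le_trans (ler_enormD _ _))// enormN lerD// OM.
Qed.

(** With an empty boundary, [dist_boundary] would be the default value 0 of [inf]. Translating a
    point of [Omega] by the constant vector [M], with [M] above the diameter, leaves [Omega], so a
    segment crosses the boundary. *)
Lemma boundary_neq0 : (0 < N)%N -> boundary Omega !=set0.
Proof.
move=> N0; have [oO _ [x Ox] _] := bO; have [M M0 HM] := bounded_domain_diam.
have [|z Bz _] := @segment_boundary _ _ _ x (x + const_mx M) Ox.
  move=> /(HM _ _ Ox); rewrite opprD addrA subrr add0r enormN ltNge => /negP; apply.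
  have := @coord_le_enorm R N (const_mx M) (Ordinal N0).
  by rewrite mxE gtr0_norm.
by exists z.
Qed.

End bounded.

(** * Lebesgue measure and Riesz potentials *)

Section box.
Context (R : realType) (N : nat).
Implicit Types (x y z : 'rV[R]_N) (r : R).
Notation mu := (lebesgue_rV R N).

(** Open balls of the sup norm: their measure is an explicit product, so they replace Euclidean
    balls in all volume computations. *)
Definition box x r : set 'rV[R]_N := [set y | forall i, `|x ord0 i - y ord0 i| < r].

Lemma boxE x r : box x r = [set y | forall i, ball (x ord0 i) r (y ord0 i)].
Proof. by []. Qed.

Lemma measurable_box x r : measurable (box x r).
Proof.
rewrite [X in measurable X](_ : _ = \big[setI/setT]_(i < N)
    ((fun y : 'rV[R]_N => y ord0 i) @^-1` (ball (x ord0 i) r))); last first.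
  rewrite -bigcap_seq; apply/seteqP; split => y /= h i; first by move=> _; exact: h.
  by apply: h; rewrite /= mem_index_enum.
apply: bigsetI_measurable => i _.
rewrite -[X in measurable X]setTI; apply: measurable_coord => //.
exact: measurable_ball.
Qed.

Lemma lebesgue_box x r : 0 <= r -> mu (box x r) = ((r *+ 2) ^+ N)%:E.
Proof.
move=> r0; rewrite boxE (@lebesgue_rV_box _ _ (fun i => ball (x ord0 i) r)).
  under eq_bigr do rewrite lebesgue_measure_ball//.
  by rewrite prodEFin prodr_const card_ord.
by move=> i; exact: measurable_ball.
Qed.

(** The sigma-algebra is generated by the coordinates, so an open set is exhibited as a countable
    union of boxes with rational centres and radii [n.+1%:R^-1]. *)
Lemma open_measurable_rV (A : set 'rV[R]_N) : open A -> measurable A.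
Proof.
move=> oA.
pose F (q : 'rV[rat]_N * nat) := let B := box (map_mx ratr q.1) q.2.+1%:R^-1 in
  if `[< B `<=` A >] then B else set0.
rewrite (_ : A = \bigcup_q F q); last first.
  apply/seteqP; split=> [x Ax|x [q _]]; last first.
    by rewrite /F; case: asboolP => // + Bx; exact.
  have /nbhs_enormP[e e0 eA] : nbhs x A by exact: open_nbhs_nbhs.
  (* A point of the box and [x] both lie within [n.+1%:R^-1] of the centre in each coordinate, hence
     at Euclidean distance at most [2 N / (n + 1) < e] from each other. *)
  have [n ne] : exists n : nat, n.+1%:R^-1 < e / (2 * (N%:R + 1)).
    have e1 : 0 < e / (2 * (N%:R + 1)) by rewrite divr_gt0// mulr_gt0// ltr_wpDl.
    by have [n _ /(_ n)/=] := near_infty_natSinv_lt (PosNum e1); exists n; auto.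
  have n0 : 0 < n.+1%:R^-1 :> R by rewrite invr_gt0.
  have /choice[q qx] i : exists q : rat, `|ratr q - x ord0 i| < n.+1%:R^-1.
    have [|q] := @rat_in_itvoo R (x ord0 i - n.+1%:R^-1) (x ord0 i + n.+1%:R^-1).
      by rewrite ltrBlDr -addrA ltrDl addr_gt0.
    by rewrite in_itv/= => qq; exists q; rewrite ltr_distl.
  exists (\row_i q i, n) => //; rewrite /F/=; case: asboolP => [_ i|]; first by rewrite !mxE.
  case=> y By; apply: eA.
  apply: (@le_lt_trans _ _ (N%:R * (2 * n.+1%:R^-1))).
    apply: enorm_le => [|i]; first by rewrite mulr_ge0// ltW.
    have := By i; have := qx i; rewrite !mxE => h1 h2.
    rewrite -(subrK (ratr (q i)) (x ord0 i)) -addrA mulr2n mulrDl mul1r.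
    by rewrite (le_trans (ler_normD _ _))// lerD// ltW// distrC.
  apply: (@lt_trans _ _ ((N%:R + 1) * (2 * n.+1%:R^-1))).
    by rewrite ltr_pM2r ?ltrDl// mulr_gt0.
  by rewrite mulrCA mulrA mulrC -ltr_pdivlMr ?mulr_gt0 ?ltr_wpDl.
apply: countable_bigcupT_measurable; first exact: countableP.
move=> q; rewrite /F; case: asboolP => // _; exact: measurable_box.
Qed.

(** A 1-Lipschitz function has open superlevel sets. This serves both the distance to a point and
    the distance to the boundary. *)
Lemma measurable_fun_enorm_lip (f : 'rV[R]_N -> R) :
  (forall x y, f x <= enorm (x - y) + f y) -> measurable_fun setT f.
Proof.
move=> flip mD; apply: (measurability _ (RGenOInfty.measurableE R)) => //.
move=> /= _ [_ [a ->] <-]; rewrite setTI; apply: open_measurable_rV.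
rewrite openE => x /=; rewrite in_itv/= andbT => ax; apply/nbhs_enormP.
exists (f x - a) => [|y]; first by rewrite subr_gt0.
by have := flip x y; rewrite /= in_itv/= andbT; lra.
Qed.

Lemma measurable_enorm x : measurable_fun setT (fun y => enorm (x - y)).
Proof.
apply: measurable_fun_enorm_lip => y z.
by rewrite [leRHS]addrC -[enorm (y - z)]enormN opprB enorm_distD.
Qed.

Lemma lebesgue_open_gt0 (A : set 'rV[R]_N) : open A -> A !=set0 -> (0 < mu A)%E.
Proof.
move=> oA [x Ax].
have /nbhs_enormP[e e0 eA] : nbhs x A by exact: open_nbhs_nbhs.
have r0 : 0 < e / (N%:R + 1) by rewrite divr_gt0// ltr_wpDl.
apply: (@lt_le_trans _ _ (mu (box x (e / (N%:R + 1))))).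
  by rewrite lebesgue_box ?ltW// lte_fin exprn_gt0// pmulrn_lgt0.
apply: le_measure; rewrite ?inE; [exact: measurable_box|exact: open_measurable_rV|].
move=> y By; apply: eA; apply: (@le_lt_trans _ _ (N%:R * (e / (N%:R + 1)))).
  by apply: enorm_le => [|i]; rewrite ?ltW//; have := By i; rewrite !mxE.
by rewrite mulrCA gtr_pMr// ltr_pdivrMr ?ltr_wpDl// mul1r ltrDl.
Qed.

End box.

Section riesz.
Context (R : realType) (N : nat) (Omega : set 'rV[R]_N).
Hypothesis bO : bounded_domain Omega.
Notation mu := (lebesgue_rV R N).

(** Dyadic decomposition around [x]: on the shell between radii [M / 2^(k+1)] and [M / 2^k] the
    integrand is at most [c k], and the shell lies in a box of volume [(2 M / 2^k)^N]. The products
    form a geometric series of ratio [z = 2^(p - N) < 1], whose sum does not depend on [x]. *)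
Lemma riesz_potential_bounded (p : R) : 0 < p < N%:R -> exists C : R,
  0 <= C /\ forall x, Omega x ->
    (\int[mu]_(y in Omega) (enorm (x - y) `^ (- p))%:E <= C%:E)%E.
Proof.
move=> /andP[p0 pN]; have [M M0 HM] := bounded_domain_diam bO.
have mO : measurable Omega by apply: open_measurable_rV; case: bO.
pose h : R := 2^-1; have h0 : 0 < h by rewrite /h invr_gt0.
pose c k := (M * h ^+ k.+1) `^ (- p).
pose z : R := h `^ (N%:R - p).
have z0 : 0 <= z by exact: powR_ge0.
have z1 : z < 1.
  rewrite (_ : 1 = 1 `^ (N%:R - p)); last by rewrite powR1.
  by rewrite gt0_ltr_powR ?subr_gt0 ?nnegrE ?ler01 ?(ltW h0)// /h invf_lt1// ltr1n.
have c0 k : 0 <= c k by exact: powR_ge0.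
pose a := (M * h) `^ (- p) * (M *+ 2) ^+ N.
have a0 : 0 <= a by rewrite mulr_ge0 ?powR_ge0// exprn_ge0// mulrn_wge0// ltW.
exists (a / (1 - z)); split; first by rewrite divr_ge0// subr_ge0 ltW.
move=> x Ox.
pose B k := box x (M * h ^+ k).
have mB k : measurable (B k) by exact: measurable_box.
apply: (@le_trans _ _ (\int[mu]_(y in Omega) (\sum_(k <oo) (c k * \1_(B k) y)%:E))%E).
  apply: ge0_le_integral => //.
  - by move=> y _; rewrite lee_fin powR_ge0.
  - apply: measurable_funTS; apply/measurable_EFinP.
    by apply: (measurableT_comp (measurable_powR _)); exact: measurable_enorm.
  - apply: (@ge0_emeasurable_sum _ _ _ _
      (fun k y => (c k * \1_(B k) y)%:E) xpredT).
    + by move=> k y _ _; rewrite lee_fin mulr_ge0.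
    + move=> k _; apply: measurable_funTS; apply/measurable_EFinP.
      by apply: measurable_funM => //; exact: measurable_indic.
  - move=> y Oy.
    have [e0|e0] := eqVneq (enorm (x - y)) 0.
      rewrite e0 powR0 ?oppr_eq0 ?gt_eqF//.
      by apply: nneseries_ge0 => k _ _; rewrite lee_fin mulr_ge0.
    have {}e0 : 0 < enorm (x - y) by rewrite lt_neqAle eq_sym e0 enorm_ge0.
    have ex : exists k, M * h ^+ k.+1 <= enorm (x - y).
      have h1 : `|h| < 1 by rewrite ger0_norm ?ltW// /h; lra.
      have /cvgr0Pnorm_lt /(_ (enorm (x - y) / M)) := cvg_expr h1.
      case; first by rewrite divr_gt0.
      move=> k _ /(_ k.+1 (leqnSn _)) /=; rewrite ltr_pdivlMr// ger0_norm ?exprn_ge0 ?(ltW h0)//.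
      by move=> /ltW; rewrite mulrC; exists k.
    (* The index of the shell containing [y]: minimality gives the outer bound [M * h ^+ k], and for
       [k = 0] the diameter does. *)
    pose k := ex_minn ex.
    have Bk : B k y.
      have lt : enorm (x - y) < M * h ^+ k.
        rewrite /k; case: ex_minnP => -[|j] _ Hj; first by rewrite expr0 mulr1 HM.
        by rewrite ltNge; apply/negP => /Hj; rewrite ltnn.
      by move=> i; apply: le_lt_trans lt; have := coord_le_enorm (x - y) i; rewrite !mxE.
    apply: (@le_trans _ _ (c k * \1_(B k) y)%:E).
      rewrite indicE mem_set// mulr1 lee_fin /c !powRN lef_pV2 ?posrE ?powR_gt0//; last first.
        by rewrite mulr_gt0// exprn_gt0.
      have h1 : 0 <= M * h ^+ k.+1 by rewrite mulr_ge0 ?exprn_ge0 ?(ltW h0) ?(ltW M0).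
      rewrite ge0_ler_powR ?nnegrE ?(ltW p0) ?(ltW e0)//.
      by rewrite /k; case: ex_minnP.
    apply: le_trans (nneseries_lim_ge k.+1 _); last by move=> j _ _; rewrite lee_fin mulr_ge0.
    by rewrite big_mkord big_ord_recr/= leeDr// sume_ge0// => j _; rewrite lee_fin mulr_ge0.
rewrite integral_nneseries//; last 2 first.
- move=> k; apply: measurable_funTS; apply/measurable_EFinP.
  by apply: measurable_funM => //; exact: measurable_indic.
- by move=> k y _; rewrite lee_fin mulr_ge0.
have le k : (\int[mu]_(y in Omega) (c k * \1_(B k) y)%:E <= (geometric a z k)%:E)%E.
  under eq_integral do rewrite EFinM.
  have mI : measurable_fun Omega (fun y => (\1_(B k) y)%:E : \bar R).
    by apply/measurable_EFinP; apply: measurable_funTS; exact: measurable_indic.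
  rewrite (ge0_integralZl_EFin _ mO _ mI)//.
  rewrite integral_indic//.
  apply: (@le_trans _ _ ((c k)%:E * mu (B k))%E).
    apply: lee_wpmul2l; first by rewrite lee_fin.
    by apply: le_measure; rewrite ?inE//; exact: measurableI.
  rewrite lebesgue_box; last by rewrite mulr_ge0 ?exprn_ge0// ltW.
  rewrite -EFinM lee_fin /geometric /c/= /a /z.
  have -> : h `^ (N%:R - p) ^+ k = (h ^+ k) `^ (- p) * (h ^+ k) ^+ N.
    rewrite -[LHS]powR_mulrn ?powR_ge0// powRAC powR_mulrn ?(ltW h0)//.
    have hk : h ^+ k != 0 by rewrite expf_neq0// gt_eqF.
    by rewrite addrC powRD ?hk ?implybT// (powR_mulrn _ (exprn_ge0 _ (ltW h0))).
  rewrite exprS mulrA powRM; [|by rewrite mulr_ge0// ltW|by rewrite exprn_ge0// ltW].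
  by rewrite -mulrnAl exprMn; rewrite le_eqVlt; apply/orP; left; apply/eqP; ring.
apply: (@le_trans _ _ (\sum_(k <oo) (geometric a z k)%:E)%E).
  by apply: lee_nneseries => k *; [apply: integral_ge0 => y _; rewrite lee_fin mulr_ge0|exact: le].
apply: lime_le.
  by apply: is_cvg_nneseries => k _ _; rewrite lee_fin /= mulr_ge0// exprn_ge0.
apply: nearW => n; rewrite sumEFin lee_fin.
have -> : \sum_(0 <= k < n) geometric a z k = a * (1 - z ^+ n) / (1 - z).
  have := @geometric_seriesE R a z; rewrite lt_eqF// => /(_ isT)/(congr1 (fun f => f n)).
  by [].
by rewrite ler_pM2r ?invr_gt0 ?subr_gt0// ler_piMr// gerBl exprn_ge0.
Qed.


End riesz.

Lemma ge0_integral_eq0_ae d (T : measurableType d) (R : realType)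
    (m : {measure set T -> \bar R}) (f : T -> \bar R) :
  measurable_fun setT f -> (forall x, 0 <= f x)%E -> (\int[m]_x f x = 0)%E ->
  \forall x \ae m, f x = 0%E.
Proof.
move=> mf f0 If; have [+ _] := @ae_eq_integral_abs _ _ _ m _ measurableT f mf.
under eq_integral do rewrite gee0_abs//.
by move=> /(_ If); apply: filterS => x; exact.
Qed.

(** * Null sets and Tonelli's theorem on product spaces *)

Section product_ae.
Context d1 d2 (T1 : measurableType d1) (T2 : measurableType d2) (R : realType).
Variable m1 : {sigma_finite_measure set T1 -> \bar R}.
Variable m2 : {sigma_finite_measure set T2 -> \bar R}.

Lemma ae_product1 (Q : T1 * T2 -> Prop) :
  (\forall z \ae (m1 \x m2)%E, Q z) -> \forall x \ae m1, \forall y \ae m2, Q (x, y).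
Proof.
move=> [A [mA A0 AQ]].
have := ge0_integral_eq0_ae (measurable_fun_xsection m2 mA) (fun=> measure_ge0 _ _) A0.
apply: filterS => x Ax.
exists (xsection A x); split => //; first exact: measurable_xsection.
by move=> y nQ; apply/xsectionP; exact: AQ.
Qed.

Lemma ae_product2 (Q : T1 * T2 -> Prop) :
  (\forall z \ae (m1 \x m2)%E, Q z) -> \forall y \ae m2, \forall x \ae m1, Q (x, y).
Proof.
move=> [A [mA A0 AQ]].
(* The product measure integrates sections in one order only; its uniqueness gives access to the
   other order. *)
have A1 : (\int[m2]_y m1 (ysection A y) = 0)%E.
  rewrite -A0; apply/esym.
  apply: (@product_measure_unique _ _ _ _ _ _ _ (m1 \x^ m2)%E) => //.
  by move=> *; exact: product_measure2E.
have := ge0_integral_eq0_ae (measurable_fun_ysection m1 mA) (fun=> measure_ge0 _ _) A1.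
apply: filterS => y Ay.
exists (ysection A y); split => //; first exact: measurable_ysection.
by move=> x nQ; apply/ysectionP; exact: AQ.
Qed.

End product_ae.

Section tonelli_in.
Context d1 d2 (T1 : measurableType d1) (T2 : measurableType d2) (R : realType).
Variable m1 : {sigma_finite_measure set T1 -> \bar R}.
Variable m2 : {sigma_finite_measure set T2 -> \bar R}.
Variables (A : set T1) (B : set T2) (mA : measurable A) (mB : measurable B).
Variable f : T1 -> T2 -> \bar R.
Hypothesis mf : measurable_fun (A `*` B) (fun z => f z.1 z.2).
Hypothesis f0 : forall x y, (0 <= f x y)%E.

(** The kernels are measurable only on [Omega * Omega]; extension by zero reduces everything to
    Tonelli's theorem on the whole product. *)
Let g := (fun z => f z.1 z.2) \_ (A `*` B).

Let mg : measurable_fun setT g.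
Proof. by apply/measurable_restrict => //; [exact: measurableX|rewrite setTI]. Qed.

Let g0 z : (0 <= g z)%E.
Proof. by rewrite /g patchE; case: ifP. Qed.

Let gE x : A x -> (\int[m2]_(y in B) f x y = \int[m2]_y g (x, y))%E.
Proof.
move=> Ax; rewrite integral_mkcond; apply: eq_integral => y _.
by rewrite /g !patchE in_setX/= (mem_set Ax).
Qed.

Let gE2 y : B y -> (\int[m1]_(x in A) f x y = \int[m1]_x g (x, y))%E.
Proof.
move=> By; rewrite integral_mkcond; apply: eq_integral => x _.
by rewrite /g !patchE in_setX/= (mem_set By) andbT.
Qed.

Lemma measurable_integral_in : measurable_fun A (fun x => \int[m2]_(y in B) f x y)%E.
Proof.
apply: (eq_measurable_fun (fubini_F m2 g)) => [x|].
  by rewrite inE => Ax; rewrite gE.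
exact: measurable_funTS (measurable_fun_fubini_tonelli_F g mg g0).
Qed.

Lemma tonelli_in : (\int[m1]_(x in A) \int[m2]_(y in B) f x y =
  \int[m2]_(y in B) \int[m1]_(x in A) f x y)%E.
Proof.
transitivity (\int[m1]_x \int[m2]_y g (x, y))%E.
  rewrite integral_mkcond; apply: eq_integral => x _; rewrite patchE.
  case: ifPn => [|nA]; first by rewrite inE => Ax; rewrite gE.
  by rewrite integral0_eq// => y _; rewrite /g patchE in_setX/= (negPf nA).
rewrite fubini_tonelli//; apply/esym; rewrite integral_mkcond.
apply: eq_integral => y _; rewrite patchE.
case: ifPn => [|nB]; first by rewrite inE => By; rewrite gE2.
by rewrite integral0_eq// => x _; rewrite /g patchE in_setX/= (negPf nB) andbF.
Qed.

End tonelli_in.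

(** * Green potentials *)

Section ae_in.
Context (R : realType) (N : nat) (Omega : set 'rV[R]_N).
Implicit Types P Q S : 'rV[R]_N -> Prop.

Lemma ae_inS P Q : (forall x, Omega x -> P x -> Q x) ->
  ae_in Omega P -> ae_in Omega Q.
Proof. by rewrite /ae_in => PQ; apply: filterS => x Px Ox; apply: PQ => //; exact: Px. Qed.

Lemma ae_inS2 P Q S : (forall x, Omega x -> P x -> Q x -> S x) ->
  ae_in Omega P -> ae_in Omega Q -> ae_in Omega S.
Proof.
by rewrite /ae_in => PQS; apply: filterS2 => x Px Qx Ox; apply: PQS => //; [exact: Px|exact: Qx].
Qed.

End ae_in.

Section potential.
Context (R : realType) (N : nat) (Omega : set 'rV[R]_N)
  (G : 'rV[R]_N -> 'rV[R]_N -> R).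
Notation mu := (lebesgue_rV R N).
Implicit Types f g h Phi : 'rV[R]_N -> R.
Hypothesis mO : measurable Omega.
Hypothesis mG : measurable_fun (Omega `*` Omega) (fun z => G z.1 z.2).

Lemma measurable_kernel1 x : Omega x -> measurable_fun Omega (G x).
Proof.
move=> Ox; change (measurable_fun Omega ((fun z => G z.1 z.2) \o pair x)).
apply: (measurable_comp (F := Omega `*` Omega)) => //.
- exact: measurableX.
- by move=> _ [y Oy <-].
- by apply: measurable_funTS; exact: pair1_measurable.
Qed.

Lemma measurable_kernel2 y : Omega y -> measurable_fun Omega (G^~ y).
Proof.
move=> Oy; change (measurable_fun Omega ((fun z => G z.1 z.2) \o pair^~ y)).
apply: (measurable_comp (F := Omega `*` Omega)) => //.
- exact: measurableX.
- by move=> _ [x Ox <-].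
- by apply: measurable_funTS; exact: pair2_measurable.
Qed.

Lemma measurable_fun_fst f : measurable_fun Omega f ->
  measurable_fun (Omega `*` Omega) (fun z => f z.1).
Proof.
move=> mf; change (measurable_fun (Omega `*` Omega) (f \o (fun z => z.1))).
apply: (measurable_comp (F := Omega)) => //.
  by move=> _ [[x y] [/= Ox _] <-].
by apply: measurable_funTS; exact: measurable_fst.
Qed.

Lemma measurable_fun_snd f : measurable_fun Omega f ->
  measurable_fun (Omega `*` Omega) (fun z => f z.2).
Proof.
move=> mf; change (measurable_fun (Omega `*` Omega) (f \o (fun z => z.2))).
apply: (measurable_comp (F := Omega)) => //.
  by move=> _ [[x y] [/= _ Oy] <-].
by apply: measurable_funTS; exact: measurable_snd.
Qed.

(** For nonnegative [f] and [G] this is the Green potential of [f], but with value [+oo] where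
    [green_op] would fall back to a default. *)
Definition potential f x : \bar R := (\int[mu]_(y in Omega) `|f y * G x y|%:E)%E.

Lemma potential_ge0 f x : (0 <= potential f x)%E.
Proof. by apply: integral_ge0 => y _; rewrite lee_fin. Qed.

Lemma measurable_potential f : measurable_fun Omega f ->
  measurable_fun Omega (potential f).
Proof.
move=> mf; apply: (@measurable_integral_in _ _ _ _ _ mu Omega Omega mO mO
   (fun x y => `|f y * G x y|%:E)) => [|x y]; last by rewrite lee_fin.
apply/measurable_EFinP; apply: measurableT_comp => //.
by apply: measurable_funM => //; exact: measurable_fun_snd.
Qed.

Definition pairing f g : \bar R :=
  (\int[mu]_(x in Omega) (potential f x * `|g x|%:E))%E.

Lemma ae_eq_wL1norm Phi f : measurable_fun Omega Phi -> measurable_fun Omega f ->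
  ae_in Omega (fun x => 0 <= Phi x) ->
  wL1norm Omega Phi f = (\int[mu]_(x in Omega) (`|f x| * `|Phi x|)%:E)%E.
Proof.
move=> mP mf P0; apply: ae_eq_integral => //.
- apply/measurable_EFinP; apply: measurable_funM => //; exact: measurableT_comp.
- apply/measurable_EFinP; apply: measurable_funM => //; exact: measurableT_comp.
- by apply: ae_inS P0 => x Ox P0; rewrite (ger0_norm P0).
Qed.

End potential.

Section green.
Context (R : realType) (N : nat) (Omega : set 'rV[R]_N)
  (G : 'rV[R]_N -> 'rV[R]_N -> R) (s gamma c1 c2 : R).
Notation mu := (lebesgue_rV R N).
Notation potential := (potential Omega G).
Notation pairing := (pairing Omega G).
Notation profile := (green_profile Omega s gamma).
Implicit Types f g h Phi : 'rV[R]_N -> R.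
Hypothesis mO : measurable Omega.
Hypothesis mG : measurable_fun (Omega `*` Omega) (fun z => G z.1 z.2).
Hypotheses (c1_gt0 : 0 < c1) (c2_gt0 : 0 < c2).
Hypothesis hb : \forall z \ae (lebesgue_rV R N \x lebesgue_rV R N)%E,
      Omega z.1 -> Omega z.2 ->
      c1 * profile z.1 z.2 <= G z.1 z.2 <= c2 * profile z.1 z.2.

Lemma green_profile_sym x y : profile x y = profile y x.
Proof.
rewrite /green_profile (enormBC x y).
exact: mulrAC.
Qed.

Lemma green_profile_ge0 x y : 0 <= profile x y.
Proof.
by rewrite !mulr_ge0 ?invr_ge0 ?powR_ge0// le_min ler01 andbT divr_ge0 ?powR_ge0.
Qed.

Lemma green_ae1 : ae_in Omega (fun x => ae_in Omega (fun y =>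
  c1 * profile x y <= G x y <= c2 * profile x y)).
Proof.
rewrite /ae_in; apply: filterS (ae_product1 hb) => x H Ox.
by apply: filterS H => y /(_ Ox).
Qed.

Lemma green_ae2 : ae_in Omega (fun y => ae_in Omega (fun x =>
  c1 * profile x y <= G x y <= c2 * profile x y)).
Proof.
rewrite /ae_in; apply: filterS (ae_product2 hb) => y H Oy.
by apply: filterS H => x H Ox; exact: H.
Qed.

Lemma green_ae_ge0 : ae_in Omega (fun x => ae_in Omega (fun y => 0 <= G x y)).
Proof.
apply: ae_inS green_ae1 => x Ox; apply: ae_inS => y Oy /andP[+ _].
by apply: le_trans; rewrite mulr_ge0 ?green_profile_ge0// ltW.
Qed.

(** Both values are comparable to the same symmetric [profile], from above with [c2] and from below
    with [c1]. *)
Lemma green_ae_swap : ae_in Omega (fun y => ae_in Omega (fun x =>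
  `|G x y| <= c2 / c1 * `|G y x|)).
Proof.
apply: ae_inS2 green_ae1 green_ae2 => y Oy.
apply: ae_inS2 => x Ox; rewrite (green_profile_sym y x).
move: (profile x y) (green_profile_ge0 x y) => p p0 /andP[h1 h2] /andP[h3 h4].
have cp : 0 <= c1 * p by rewrite mulr_ge0// ltW.
rewrite !ger0_norm ?(le_trans cp)// (le_trans h4)// -mulrA ler_pM2l//.
by rewrite ler_pdivlMl.
Qed.

Context (lam : R) (Phi : 'rV[R]_N -> R).
Hypothesis lam_gt0 : 0 < lam.
Hypothesis mPhi : measurable_fun Omega Phi.
Hypothesis Phi_ge0 : ae_in Omega (fun x => 0 <= Phi x).
Hypothesis potentialPhi : ae_in Omega (fun x => potential Phi x = (Phi x / lam)%:E).

(** The factor [c2 / c1] pays for exchanging the arguments of [G], and [1 / lam] comes from the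
    potential of [Phi] being [Phi / lam]. *)
Let K := c2 / (c1 * lam).

(* The bounds on [G] are symmetric, although [G] itself need not be. *)
Lemma dual_potential_le g : measurable_fun Omega g ->
  ae_in Omega (fun x => `|g x| <= Phi x) ->
  ae_in Omega (fun y =>
    \int[mu]_(x in Omega) (`|G x y * g x|%:E) <= (K * Phi y)%:E)%E.
Proof.
move=> mg gPhi; apply: ae_inS2 green_ae_swap potentialPhi => y Oy Gs Py.
have mGy := measurable_kernel2 mO mG Oy; have mGy' := measurable_kernel1 mO mG Oy.
apply: (@le_trans _ _ (\int[mu]_(x in Omega) ((c2 / c1)%:E * `|Phi x * G y x|%:E))%E).
  apply: ae_ge0_le_integral => //.
  - by apply/measurable_EFinP; apply: measurableT_comp => //; apply: measurable_funM.
  - by move=> x _; rewrite -EFinM lee_fin mulr_ge0// divr_ge0 ?ltW.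
  - apply/measurable_EFinP; apply: measurable_funM => //.
    by apply: measurableT_comp => //; apply: measurable_funM.
  - apply: ae_inS2 gPhi Gs => x Ox gx Gx.
    rewrite -EFinM lee_fin !normrM (mulrC `|Phi x|) mulrA ler_pM//.
    by rewrite (le_trans gx)// ler_norm.
rewrite ge0_integralZl_EFin//.
- rewrite -/(potential Phi y) Py -EFinM lee_fin /K invfM.
  by rewrite le_eqVlt; apply/orP; left; apply/eqP; ring.
- apply/measurable_EFinP.
  by apply: measurableT_comp => //; apply: measurable_funM.
- by rewrite divr_ge0 ?ltW.
Qed.

Lemma pairing_swap f g : measurable_fun Omega f -> measurable_fun Omega g ->
  pairing f g = (\int[mu]_(y in Omega) (`|f y|%:E *
    \int[mu]_(x in Omega) `|G x y * g x|%:E))%E.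
Proof.
move=> mf mg.
transitivity (\int[mu]_(x in Omega) \int[mu]_(y in Omega) `|f y * G x y * g x|%:E)%E.
  apply: eq_integral => x; rewrite inE => Ox.
  rewrite -ge0_integralZr//; last first.
    apply/measurable_EFinP; apply: measurableT_comp => //; apply: measurable_funM => //.
    exact: (measurable_kernel1 mO mG).
  by apply: eq_integral => y _; rewrite -EFinM -normrM.
rewrite tonelli_in//; last first.
  apply/measurable_EFinP; apply: measurableT_comp => //; apply: measurable_funM => //.
    apply: measurable_funM => //; exact: measurable_fun_snd.
  exact: measurable_fun_fst.
apply: eq_integral => y; rewrite inE => Oy.
rewrite -ge0_integralZl_EFin//.
  by apply: eq_integral => x _; rewrite -EFinM -normrM mulrA.
apply/measurable_EFinP; apply: measurableT_comp => //; apply: measurable_funM => //.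
exact: (measurable_kernel2 mO mG).
Qed.

(** By Tonelli the pairing integrates [|f|] against the transposed potential of [g], which is at
    most [K * Phi]. This is what makes pairings with elements of the weighted space finite. *)
Lemma pairing_le f g : measurable_fun Omega f -> measurable_fun Omega g ->
  ae_in Omega (fun x => `|g x| <= Phi x) ->
  (pairing f g <= K%:E * wL1norm Omega Phi f)%E.
Proof.
move=> mf mg gPhi; rewrite pairing_swap// ae_eq_wL1norm//.
have K0 : 0 <= K by rewrite divr_ge0 ?mulr_ge0 ?ltW.
rewrite -ge0_integralZl_EFin//; last first.
  by apply/measurable_EFinP; apply: measurable_funM => //; exact: measurableT_comp.
apply: ae_ge0_le_integral => //.
- by move=> y _; rewrite mule_ge0 ?lee_fin// integral_ge0.
- apply: emeasurable_funM; first by apply/measurable_EFinP; exact: measurableT_comp.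
  have := @measurable_integral_in _ _ _ _ _ mu Omega Omega mO mO
    (fun y x => `|G x y * g x|%:E).
  apply => [|//]; apply/measurable_EFinP; apply: measurableT_comp => //.
  apply: measurable_funM; last exact: measurable_fun_snd.
  change (measurable_fun (Omega `*` Omega) ((fun z => G z.1 z.2) \o (fun z => (z.2, z.1)))).
  apply: (measurable_comp (F := Omega `*` Omega)) => //.
  + exact: measurableX.
  + by move=> _ [[x y] [/= Ox Oy] <-].
  + by apply: measurable_funTS; apply: measurable_fun_pair.
- by move=> y _; apply: mule_ge0; rewrite lee_fin// mulr_ge0.
- apply/measurable_EFinP; apply: measurable_funM => //.
  by apply: measurable_funM => //; exact: measurableT_comp.
- apply: ae_inS2 (dual_potential_le mg gPhi) Phi_ge0 => y Oy h P0.
  by rewrite -EFinM mulrCA EFinM (ger0_norm P0); apply: lee_wpmul2l => //; rewrite lee_fin.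
Qed.

(** Potentials are subadditive, so the previous bound applies to [f - h]. Along a curve continuous
    in the weighted norm, it yields continuity of the pairing in time, without any subtraction of
    possibly infinite values. *)
Lemma pairing_lip f h g : measurable_fun Omega f -> measurable_fun Omega h ->
  measurable_fun Omega g -> ae_in Omega (fun x => `|g x| <= Phi x) ->
  (pairing f g <= pairing h g + K%:E * wL1norm Omega Phi (f - h)%R)%E.
Proof.
move=> mf mh mg gPhi.
have mfh : measurable_fun Omega (f - h) by exact: measurable_funB.
apply: le_trans (leeD2l _ (pairing_le mfh mg gPhi)).
have mp (k : 'rV[R]_N -> R) : measurable_fun Omega k ->
    measurable_fun Omega (fun x => potential k x * `|g x|%:E)%E.
  move=> mk; apply: emeasurable_funM; first exact: measurable_potential.
  by apply/measurable_EFinP; exact: measurableT_comp.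
have p0 k x : (0 <= potential k x * `|g x|%:E)%E.
  by rewrite mule_ge0// potential_ge0.
rewrite /pairing -ge0_integralD//; [|exact: mp|exact: mp].
apply: ge0_le_integral => //.
- exact: mp.
- by apply: emeasurable_funD; exact: mp.
move=> x Ox; rewrite -ge0_muleDl ?potential_ge0//; apply: lee_wpmul2r => //.
have mk (k : 'rV[R]_N -> R) : measurable_fun Omega k ->
    measurable_fun Omega (fun y => `|k y * G x y|%:E).
  move=> mk; apply/measurable_EFinP; apply: measurableT_comp => //.
  by apply: measurable_funM => //; exact: (measurable_kernel1 mO mG).
rewrite /potential -ge0_integralD//; [|exact: mk|exact: mk].
apply: ge0_le_integral => //.
- exact: mk.
- by apply: emeasurable_funD; exact: mk.
move=> y Oy; rewrite -EFinD lee_fin -[in leLHS](subrK (h y) (f y)) addrC.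
by rewrite mulrDl ler_normD.
Qed.

End green.

Section eigen.
Context (R : realType) (N : nat) (Omega : set 'rV[R]_N)
  (G : 'rV[R]_N -> 'rV[R]_N -> R) (D : set ('rV[R]_N -> R))
  (L : ('rV[R]_N -> R) -> ('rV[R]_N -> R)) (lam : R) (Phi : 'rV[R]_N -> R).
Notation mu := (lebesgue_rV R N).
Hypothesis mO : measurable Omega.
Hypothesis hL : densely_defined_linear Omega D L.
Hypothesis hG : green_left_inverse Omega D L G.
Hypothesis G0 : ae_in Omega (fun x => ae_in Omega (fun y => 0 <= G x y)).
Hypothesis lam_gt0 : 0 < lam.
Hypothesis DPhi : D Phi.
Hypothesis LPhi : eqae Omega (L Phi) (lam *: Phi).
Hypothesis Phi_ge0 : ae_in Omega (fun x => 0 <= Phi x).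

(** The left inverse applied to [L Phi = lam *: Phi] gives the eigenvalue equation in integral form;
    nonnegativity of [Phi] and [G] removes the absolute value. *)
Lemma potential_eigenfunction :
  ae_in Omega (fun x => potential Omega G Phi x = (Phi x / lam)%:E).
Proof.
have mL : measurable_fun Omega (L Phi).
  by have /integrableP[/measurable_EFinP] := op_L1 hL DPhi.
have mP : measurable_fun Omega Phi.
  by have /integrableP[/measurable_EFinP] := dom_L1 hL DPhi.
have mG := green_measurable hG.
have /(ae_inS2 _ (green_integrable hG (op_L1 hL DPhi))) := green_opK hG DPhi.
move/(_ (fun x => L1 Omega (fun y => L Phi y * G x y) /\ green_op Omega G (L Phi) x = Phi x)).
move/(_ (fun x _ h1 h2 => conj h1 h2)).
move: G0; apply: ae_inS2 => x Ox Gx [iL] <-.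
have mGx := measurable_kernel1 mO mG Ox.
have : potential Omega G Phi x =
    (\int[mu]_(y in Omega) ((lam^-1)%:E * (L Phi y * G x y)%:E))%E.
  apply: ae_eq_integral => //.
  - apply/measurable_EFinP; apply: measurableT_comp => //.
    exact: measurable_funM.
  - by apply: measurable_funeM; apply/measurable_EFinP; exact: measurable_funM.
  - have : ae_in Omega (fun y => 0 <= Phi y /\ 0 <= G x y).
      by move: Phi_ge0 Gx; apply: ae_inS2.
    move: LPhi; apply: ae_inS2 => y Oy Ly [P0 Gy].
    rewrite ger0_norm ?mulr_ge0// -EFinM Ly; congr EFin.
    by rewrite mulrA mulrA mulVf ?gt_eqF// mul1r.
move=> ->; rewrite integralZl//.
rewrite -(fineK (integrable_fin_num mO iL)) -EFinM mulrC.
by rewrite /green_op /Rintegral.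
Qed.

End eigen.

Section null.
Context (R : realType) (N : nat).
Notation mu := (lebesgue_rV R N).

Lemma ae_neq (x : 'rV[R]_N) : (0 < N)%N -> \forall y \ae mu, y != x.
Proof.
move=> N0; have := @lebesgue_rV_box R N (fun i => [set x ord0 i]) (fun i => measurable_set1 _).
under eq_bigr do rewrite lebesgue_measure_set1.
rewrite (bigD1 (Ordinal N0))//= mul0e => m0.
set A := (X in mu X) in m0.
have AE : A = [set x].
  apply/seteqP; split => [y /= h|y -> //].
  by apply/rowP => i; rewrite h.
exists A; split => //.
- have -> : A = \bigcap_n box x n.+1%:R^-1.
    rewrite AE; apply/seteqP; split => [y -> n _ i|y h].
      by rewrite subrr normr0 invr_gt0.
    apply/rowP => i; apply/eqP; rewrite eq_sym -subr_eq0 -normr_le0.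
    apply/ler_addgt0Pl => e e0; rewrite addr0.
    have [n _ /(_ n)/=] := near_infty_natSinv_lt (PosNum e0) => /(_ (leqnn _)) ne.
    by apply/ltW/(lt_trans _ ne); exact: h.
  by apply: bigcap_measurable => // n _; exact: measurable_box.
- by move=> y /=; rewrite AE => /negP/negPn/eqP.
Qed.

End null.

Section powR_aux.
Context (R : realType).
Implicit Types a b c d e g r : R.

Lemma le_powRr a b r : 0 <= r -> 0 <= a -> a <= b -> a `^ r <= b `^ r.
Proof. by move=> r0 a0 ab; rewrite ge0_ler_powR// nnegrE// (le_trans a0). Qed.

Lemma le_powRN a b r : 0 <= r -> 0 < a -> a <= b -> b `^ (- r) <= a `^ (- r).
Proof.
move=> r0 a0 ab; have b0 := lt_le_trans a0 ab.
by rewrite !powRN lef_pV2 ?posrE ?powR_gt0// le_powRr// ltW.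
Qed.

Lemma powR_divr a b r : 0 < b -> 0 <= a -> a `^ r / b `^ r = (a / b) `^ r.
Proof.
move=> b0 a0; rewrite powRM ?invr_ge0 ?(ltW b0)//; congr (_ * _).
by rewrite -[in RHS]powR_inv1 ?(ltW b0)// -powRrM mulN1r powRN.
Qed.

(** If [d <= r], the minimum is at most [(d / r)^b] and [d + r <= 2 r]. Otherwise it is at most 1,
    [d + r <= 2 d], and [d^(a - b) <= r^(a - b)] because the exponent is nonpositive. The bound
    [a <= 1] turns [2^a] into 2. *)
Lemma min_powR_le d r a b g : 0 <= d -> 0 < r -> 0 <= a -> a <= 1 -> a <= b -> b <= g ->
  0 < d -> Num.min (d `^ g / r `^ g) 1 * (d + r) `^ a <= 2 * (d `^ b * r `^ (a - b)).
Proof.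
move=> d0 r0 a0 a1 ab bg dp.
have two t : 0 <= t -> (2 * t) `^ a <= 2 * t `^ a.
  move=> t0; rewrite powRM// ler_wpM2r ?powR_ge0//.
  by rewrite ler1_powR// ler1n.
have [dr|rd] := leP d r.
  apply: (@le_trans _ _ ((d / r) `^ b * (2 * r `^ a))).
    apply: ler_pM; rewrite ?powR_ge0//.
    - by rewrite le_min ler01 divr_ge0 ?powR_ge0.
    - rewrite ge_min powR_divr//; apply/orP; left.
      by apply: ger_powR; rewrite ?divr_gt0// ler_pdivrMr// mul1r.
    - rewrite (le_trans _ (two _ (ltW r0)))//; apply: le_powRr => //.
        by rewrite addr_ge0// ltW.
      by rewrite mulr2n mulrDl mul1r lerD2r.
  rewrite -powR_divr// mulrCA ler_pM2l// -mulrA ler_wpM2l ?powR_ge0//.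
  by rewrite powRD ?powRN 1?mulrC// (gt_eqF r0) implybT.
apply: (@le_trans _ _ (1 * (2 * d `^ a))).
  apply: ler_pM; rewrite ?powR_ge0//.
  - by rewrite le_min ler01 divr_ge0 ?powR_ge0.
  - rewrite (le_trans _ (two _ d0))//; apply: le_powRr => //.
      by rewrite addr_ge0// ltW.
    by rewrite mulr2n mulrDl mul1r lerD2l ltW.
have -> : d `^ a = d `^ b * d `^ (a - b).
  by rewrite -powRD ?subrKC// (gt_eqF dp) implybT.
rewrite mul1r ler_pM2l//.
rewrite ler_wpM2l ?powR_ge0// -opprB; apply: le_powRN => //; last exact: ltW.
by rewrite subr_ge0.
Qed.

End powR_aux.

(** * Bounds on the first eigenfunction *)

Section profile.
Context (R : realType) (N : nat) (Omega : set 'rV[R]_N) (s gamma : R).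
Notation d := (dist_boundary Omega).
Notation profile := (green_profile Omega s gamma).
Hypothesis hNs : 2 * s < N%:R.
Hypothesis gamma_ge0 : 0 <= gamma.
Implicit Types (x y : 'rV[R]_N) (a b M : R).

Lemma green_profile_near x y : 0 < enorm (x - y) ->
  enorm (x - y) <= d x -> enorm (x - y) <= d y ->
  profile x y = enorm (x - y) `^ (- (N%:R - 2 * s)).
Proof.
rewrite /green_profile powRN; move: (d x) (d y) (enorm _) => dx dy r r0 rx ry.
have m t : r <= t -> Num.min (t `^ gamma / r `^ gamma) 1 = 1.
  move=> rt; apply/min_idPr; rewrite ler_pdivlMr ?powR_gt0// mul1r le_powRr//.
  exact: ltW.
by rewrite !m// !mulr1.
Qed.

(** A crude bound, valid far from the diagonal as well: it separates the variables into
    [d(x)^gamma d(y)^gamma], which is the source of the lower bound on the eigenfunction. *)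
Lemma green_profile_ge x y M : 0 < enorm (x - y) -> enorm (x - y) <= M ->
  d x <= M -> d y <= M ->
  M `^ (- (N%:R - 2 * s)) * (d x `^ gamma / M `^ gamma) * (d y `^ gamma / M `^ gamma) <=
  profile x y.
Proof.
rewrite /green_profile.
move: (dist_boundary_ge0 Omega x) (dist_boundary_ge0 Omega y).
move: (d x) (d y) (enorm _) => dx dy r x0 y0 r0 rM xM yM.
have M0 : 0 < M := lt_le_trans r0 rM.
have m t : 0 <= t -> t <= M ->
    0 <= t `^ gamma / M `^ gamma <= Num.min (t `^ gamma / r `^ gamma) 1.
  move=> t0 tM; rewrite divr_ge0 ?powR_ge0//= le_min.
  apply/andP; split; last by rewrite ler_pdivrMr ?powR_gt0// mul1r le_powRr.
  rewrite ler_wpM2l ?powR_ge0// lef_pV2 ?posrE ?powR_gt0//.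
  by apply: le_powRr => //; exact: ltW.
have /andP[? ?] := m _ x0 xM; have /andP[? ?] := m _ y0 yM.
rewrite -(powRN r); apply: ler_pM => //; first by rewrite mulr_ge0 ?powR_ge0.
apply: ler_pM => //; first exact: powR_ge0.
by apply: le_powRN => //; rewrite subr_ge0 ltW.
Qed.

(** The base [d x + enorm (x - y)] is the Lipschitz majorant of [d y], so the left side controls the
    kernel times [d(y)^a]. The minimum at [y] is bounded by 1; the minimum at [x] is traded for
    [d(x)^b] at the price of a stronger singularity. *)
Lemma green_profile_le x y a b : 0 < d x -> 0 <= a -> a <= 1 -> a <= b -> b <= gamma ->
  profile x y * (d x + enorm (x - y)) `^ a <=
  2 * d x `^ b * enorm (x - y) `^ (- (N%:R - 2 * s - a + b)).
Proof.
move=> x0 a0 a1 ab bg.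
(* On the diagonal the profile is 0, because 0^-1 = 0. *)
have [e0|e0] := eqVneq (enorm (x - y)) 0.
  rewrite /green_profile e0 [0 `^ (N%:R - _)]powR0 ?invr0 ?mul0r; last first.
    by rewrite gt_eqF// subr_gt0.
  by rewrite mulr_ge0 ?powR_ge0// mulr_ge0 ?powR_ge0.
have {}e0 : 0 < enorm (x - y) by rewrite lt_neqAle eq_sym e0 enorm_ge0.
rewrite /green_profile -powRN.
move: (dist_boundary_ge0 Omega y); move: (d x) (d y) (enorm _) x0 e0 => dx dy r x0 r0 y0.
apply: (@le_trans _ _ (r `^ (- (N%:R - 2 * s)) *
    (Num.min (dx `^ gamma / r `^ gamma) 1 * (dx + r) `^ a))).
  rewrite mulrA ler_wpM2r ?powR_ge0// ler_piMr//.
    by rewrite mulr_ge0 ?powR_ge0// le_min ler01 divr_ge0 ?powR_ge0.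
apply: (@le_trans _ _ (r `^ (- (N%:R - 2 * s)) * (2 * (dx `^ b * r `^ (a - b))))).
  by rewrite ler_wpM2l ?powR_ge0// min_powR_le// ltW.
have -> : r `^ (- (N%:R - 2 * s - a + b)) = r `^ (- (N%:R - 2 * s)) * r `^ (a - b).
  rewrite -powRD; last by rewrite (gt_eqF r0) implybT.
  by congr (_ `^ _); ring.
by rewrite le_eqVlt; apply/orP; left; apply/eqP; ring.
Qed.

End profile.

Section domain_bound.
Context (R : realType) (N : nat) (Omega : set 'rV[R]_N).
Hypothesis (bO : bounded_domain Omega) (N0 : (0 < N)%N).
Notation d := (dist_boundary Omega).

Lemma bounded_domain_bound : exists M : R, [/\ 0 < M,
  forall x y, Omega x -> Omega y -> enorm (x - y) <= M &
  forall x, Omega x -> d x <= M].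
Proof.
have [M M0 HM] := bounded_domain_diam bO; have B0 := boundary_neq0 bO N0.
have [x0 Ox0 x01] := dist_boundary_small B0 ltr01.
exists (M + 1); split; first by rewrite addr_gt0.
  by move=> x y Ox Oy; rewrite (le_trans (ltW (HM _ _ Ox Oy)))// lerDl.
move=> x Ox; rewrite (le_trans (dist_boundary_lip B0 x x0))//.
by rewrite lerD ?ltW// HM.
Qed.

End domain_bound.

Section bounds.
Context (R : realType) (N : nat) (Omega : set 'rV[R]_N)
  (G : 'rV[R]_N -> 'rV[R]_N -> R) (s gamma c1 c2 : R).
Notation mu := (lebesgue_rV R N).
Notation potential := (potential Omega G).
Notation d := (dist_boundary Omega).
Notation profile := (green_profile Omega s gamma).
Implicit Types f g h : 'rV[R]_N -> R.
Hypotheses (bO : bounded_domain Omega) (N0 : (0 < N)%N).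
Hypothesis mG : measurable_fun (Omega `*` Omega) (fun z => G z.1 z.2).
Hypotheses (c1_gt0 : 0 < c1) (c2_gt0 : 0 < c2).
Hypotheses (s_gt0 : 0 < s) (hNs : 2 * s < N%:R) (hgamma : 0 < gamma <= 1).
Hypothesis hb : \forall z \ae (lebesgue_rV R N \x lebesgue_rV R N)%E,
      Omega z.1 -> Omega z.2 ->
      c1 * profile z.1 z.2 <= G z.1 z.2 <= c2 * profile z.1 z.2.

Let mO : measurable Omega.
Proof. by apply: open_measurable_rV; case: bO. Qed.

Let B0 : boundary Omega !=set0.
Proof. exact: boundary_neq0. Qed.

Let gamma_ge0 : 0 <= gamma.
Proof. by case/andP: hgamma => /ltW. Qed.

Let d_gt0 x : Omega x -> 0 < d x.
Proof. by apply: dist_boundary_gt0 => //; case: bO. Qed.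

Let enorm_gt0 (x y : 'rV[R]_N) : y != x -> 0 < enorm (x - y).
Proof.
move=> yx; rewrite lt_neqAle enorm_ge0 andbT eq_sym.
by apply: contra yx => /eqP/enorm_eq0/eqP; rewrite subr_eq0 eq_sym.
Qed.

Lemma potential_ge f k beta : measurable_fun Omega f -> 0 < k -> 0 <= beta ->
  ae_in Omega (fun y => k * d y `^ beta <= f y) ->
  exists2 c : R, 0 < c &
    ae_in Omega (fun x => (c * d x `^ (2 * s + beta))%:E <= potential f x)%E.
Proof.
move=> mf k0 b0 fk.
pose p := N%:R - 2 * s.
have p0 : 0 < p by rewrite /p subr_gt0.
(* The two powers of 1/2 come from evaluating the kernel and [f] at scale [d x / 2]; [N^-N] is the
   volume of the box below divided by [d(x)^N]. *)
pose c := c1 * k * (2^-1 `^ (- p) * 2^-1 `^ beta) * (N%:R^-1) ^+ N.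
have Np : 0 < N%:R^-1 :> R by rewrite invr_gt0 ltr0n.
have h0 : 0 < 2^-1 :> R by rewrite invr_gt0.
exists c; first by rewrite !mulr_gt0// ?powR_gt0// exprn_gt0.
have Gae := green_ae1 hb.
move: Gae; apply: ae_inS => x Ox Gx.
have dx := d_gt0 Ox.
(* With this radius the box lies in the Euclidean ball of radius [d x / 2]. There [enorm (x - y)] is
   below both distances to the boundary, so both minima in the profile equal 1. *)
pose r := d x / 2 / N%:R; pose B := box x r.
have r0 : 0 < r by rewrite !divr_gt0// ltr0n.
have mB : measurable B by exact: measurable_box.
have Bd y : B y -> enorm (x - y) <= d x / 2.
  move=> By; have -> : d x / 2 = N%:R * r by rewrite /r mulrCA mulfV ?mulr1// pnatr_eq0 -lt0n.
  by apply: enorm_le => [|i]; [exact: ltW|rewrite !mxE ltW//; exact: By].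
have d2 : d x / 2 < d x by rewrite ltr_pdivrMr// ltr_pMr// ltr1n.
have BO : B `<=` Omega.
  by move=> y By; apply: (dist_boundary_ball Ox); exact: le_lt_trans (Bd _ By) d2.
have mGx := measurable_kernel1 mO mG Ox.
have mfG : measurable_fun Omega (fun y => `|f y * G x y|%:E).
  apply/measurable_EFinP; apply: measurableT_comp => //; exact: measurable_funM.
pose v := c1 * (d x / 2) `^ (- p) * (k * (d x / 2) `^ beta).
have hx : 0 < d x / 2 by rewrite divr_gt0.
have v0 : 0 <= v by rewrite ltW// !mulr_gt0// powR_gt0.
apply: (@le_trans _ _ (\int[mu]_(y in B) `|f y * G x y|%:E)%E); last first.
  by apply: ge0_subset_integral => // y _; rewrite lee_fin.
apply: (@le_trans _ _ (\int[mu]_(y in B) (cst v%:E y))%E).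
  rewrite integral_cst// [X in (_ * X)%E](lebesgue_box x (ltW r0)) -EFinM lee_fin.
  have -> : r *+ 2 = d x * N%:R^-1 by rewrite /r -mulr_natr; field; rewrite pnatr_eq0 -lt0n.
  rewrite /v /c !(powRM _ (ltW dx)) ?(ltW h0)// exprMn.
  have -> : d x `^ (2 * s + beta) = d x `^ (- p) * d x `^ beta * d x ^+ N.
    have dn : d x != 0 by rewrite gt_eqF.
    rewrite -powR_mulrn ?(ltW dx)// -!powRD ?dn ?implybT//; congr (_ `^ _).
    by rewrite /p; ring.
  by rewrite le_eqVlt; apply/orP; left; apply/eqP; ring.
apply: ae_ge0_le_integral => //.
- exact: measurable_funS mfG.
have H : ae_in Omega (fun y => (y != x) /\
    c1 * profile x y <= G x y /\ k * d y `^ beta <= f y).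
  have ne : ae_in Omega (fun y => y != x).
    by rewrite /ae_in; apply: filterS (ae_neq x N0).
  have : ae_in Omega (fun y => c1 * profile x y <= G x y /\ k * d y `^ beta <= f y).
    by move: Gx fk; apply: ae_inS2 => y _ /andP[].
  by move: ne; apply: ae_inS2.
rewrite /ae_in in H; apply: filterS H => y H By.
have Oy := BO _ By; have [yx [h1 h2]] := H Oy.
have e0 := enorm_gt0 yx; have e1 := Bd _ By.
have dy : d x / 2 <= d y.
  have := dist_boundary_lip B0 x y; rewrite -lerBlDl; apply: le_trans.
  by move: e1; lra.
rewrite lee_fin /v mulrC.
rewrite green_profile_near// in h1; last 2 first.
- by rewrite (le_trans e1)// ltW.
- exact: le_trans e1 dy.
have h3 : c1 * (d x / 2) `^ (- p) <= G x y.
  by apply: le_trans h1; rewrite ler_pM2l// le_powRN// ltW.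
have h4 : k * (d x / 2) `^ beta <= f y.
  by apply: le_trans h2; rewrite ler_pM2l// le_powRr// ltW.
rewrite (le_trans _ (ler_norm _))// ler_pM//; apply/ltW/mulr_gt0 => //; exact: powR_gt0.
Qed.

Context (lam : R) (Phi : 'rV[R]_N -> R).
Hypothesis lam_gt0 : 0 < lam.
Hypothesis mPhi : measurable_fun Omega Phi.
Hypothesis Phi_ge0 : ae_in Omega (fun x => 0 <= Phi x).
Hypothesis Phi_neq0 : ~ eqae Omega Phi 0.
Hypothesis potentialPhi : ae_in Omega (fun x => potential Phi x = (Phi x / lam)%:E).

Let md : measurable_fun setT d.
Proof. by apply: measurable_fun_enorm_lip => x y; exact: dist_boundary_lip. Qed.

(** A Hopf-type bound: in [Phi = lam G Phi] the kernel dominates a multiple of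
    [d(x)^gamma d(y)^gamma], which leaves [d(x)^gamma] times a weighted integral of [Phi], positive
    because [Phi] is not almost everywhere zero. *)
Lemma eigenfunction_ge : exists2 c : R, 0 < c &
  ae_in Omega (fun x => c * d x `^ gamma <= Phi x).
Proof.
have [M [M0 HM dM]] := bounded_domain_bound bO N0.
pose I := (\int[mu]_(y in Omega) (d y `^ gamma * `|Phi y|)%:E)%E.
have mI : measurable_fun Omega (fun y => (d y `^ gamma * `|Phi y|)%:E).
  apply/measurable_EFinP; apply: measurable_funM; last exact: measurableT_comp.
  by apply: measurable_funTS; apply: (measurableT_comp (measurable_powR _)).
have I0 : (0 < I)%E.
  rewrite lt_neqAle integral_ge0 ?andbT//; last first.
    by move=> y _; rewrite lee_fin mulr_ge0 ?powR_ge0.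
  apply/eqP => I0; apply: Phi_neq0.
  have [+ _] := @ae_eq_integral_abs _ _ _ mu _ mO _ mI.
  under eq_integral do rewrite gee0_abs ?lee_fin ?mulr_ge0 ?powR_ge0//.
  move=> /(_ (esym I0)); apply: filterS => y h Oy.
  have /eqP := h Oy; rewrite eqe mulf_eq0 normr_eq0 => /orP[|/eqP//].
  by rewrite gt_eqF// powR_gt0// d_gt0.
(* Truncation at 1 gives a finite positive number without proving that [I] is finite. *)
pose i0 := fine (mine I 1%E).
have i0_gt0 : 0 < i0.
  rewrite /i0 fine_gt0// lt_min I0 lte01/=.
  by rewrite gt_min ltry orbT.
have i0I : (i0%:E <= I)%E.
  rewrite /i0 fineK ?ge_min ?lexx//.
  rewrite ge0_fin_numE; last by rewrite le_min (ltW I0) lee01.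
  by rewrite gt_min ltry orbT.
have [c c_gt0 cE] : exists2 c, 0 < c &
    c = c1 * (M `^ (- (N%:R - 2 * s)) / M `^ gamma / M `^ gamma).
  by eexists; [|reflexivity]; rewrite mulr_gt0// !divr_gt0// powR_gt0.
exists (lam * (c * i0)); first by do 2 (apply: mulr_gt0 => //).
move: (green_ae1 hb) potentialPhi; apply: ae_inS2 => x Ox Gx Px.
have mGx := measurable_kernel1 mO mG Ox.
rewrite -mulrA mulrC -ler_pdivlMr// -lee_fin -Px.
apply: (@le_trans _ _ ((c * d x `^ gamma)%:E * I)%E).
  rewrite mulrAC EFinM; apply: lee_wpmul2l => //.
  by rewrite lee_fin mulr_ge0 ?powR_ge0// ltW.
rewrite -ge0_integralZl_EFin//; last 2 first.
- by move=> y _; rewrite lee_fin mulr_ge0 ?powR_ge0.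
- by rewrite mulr_ge0 ?powR_ge0// ltW.
apply: ae_ge0_le_integral => //.
- by move=> y _; rewrite -EFinM lee_fin !mulr_ge0 ?powR_ge0// ltW.
- exact: measurable_funeM.
- apply/measurable_EFinP; apply: measurableT_comp => //; exact: measurable_funM.
have ne : ae_in Omega (fun y => y != x).
  by rewrite /ae_in; apply: filterS (ae_neq x N0).
move: ne Gx; apply: ae_inS2 => y Oy yx /andP[h1 _].
have h2 := green_profile_ge hNs gamma_ge0 (enorm_gt0 yx) (HM _ _ Ox Oy) (dM _ Ox) (dM _ Oy).
rewrite -EFinM lee_fin normrM mulrA (mulrC `|Phi y|); apply: ler_wpM2r => //.
apply: le_trans (ler_norm _); apply: le_trans h1.
apply: (@le_trans _ _ (c1 * (M `^ (- (N%:R - 2 * s)) *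
    (d x `^ gamma / M `^ gamma) * (d y `^ gamma / M `^ gamma)))).
  by rewrite le_eqVlt; apply/orP; left; apply/eqP; rewrite cE; ring.
by rewrite ler_pM2l.
Qed.

Lemma eigenfunction_le_step a b A : 0 <= A -> 0 <= a -> a <= b -> b <= gamma ->
  b < a + 2 * s -> ae_in Omega (fun x => Phi x <= A * d x `^ a) ->
  exists2 A' : R, 0 <= A' & ae_in Omega (fun x => Phi x <= A' * d x `^ b).
Proof.
move=> A0 a0 ab bg bas PA.
(* The order of the remaining singularity. It is positive by [2 * s < N] and [a <= b], and below [N]
   exactly because [b < a + 2 * s]. *)
pose p := N%:R - 2 * s - a + b.
have [|C [C0 HC]] := @riesz_potential_bounded R N Omega bO p.
  by apply/andP; split; rewrite /p; move: hNs ab bas; lra.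
exists (lam * (c2 * A * 2 * C)); first by rewrite !mulr_ge0// ltW.
have Gge0 := green_ae_ge0 c1_gt0 hb.
have Gle : ae_in Omega (fun x => ae_in Omega (fun y => `|G x y| <= c2 * profile x y)).
  move: Gge0 (green_ae1 hb); apply: ae_inS2 => x Ox; apply: ae_inS2 => y Oy ? /andP[_].
  by rewrite ger0_norm.
move: Gle potentialPhi; apply: ae_inS2 => x Ox Gx Px.
have mGx := measurable_kernel1 mO mG Ox.
rewrite -mulrA mulrC -ler_pdivrMr// -lee_fin -Px.
have me : measurable_fun Omega (fun y => (enorm (x - y) `^ (- p))%:E).
  apply: measurable_funTS; apply/measurable_EFinP.
  by apply: (measurableT_comp (measurable_powR _)); exact: measurable_enorm.
apply: (@le_trans _ _ (\int[mu]_(y in Omega)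
   ((c2 * A * 2 * d x `^ b)%:E * (enorm (x - y) `^ (- p))%:E))%E); last first.
  rewrite ge0_integralZl_EFin//; last 2 first.
  - by move=> y _; rewrite lee_fin powR_ge0.
  - by rewrite !mulr_ge0 ?powR_ge0// ltW.
  rewrite [in leRHS]mulrAC [leRHS]EFinM; apply: lee_wpmul2l; last exact: HC.
  by rewrite lee_fin !mulr_ge0 ?powR_ge0// ltW.
apply: ae_ge0_le_integral => //.
- apply/measurable_EFinP; apply: measurableT_comp => //; exact: measurable_funM.
- by move=> y _; rewrite -EFinM lee_fin !mulr_ge0 ?powR_ge0// ltW.
- exact: measurable_funeM.
have PA' : ae_in Omega (fun y => `|Phi y| <= A * d y `^ a).
  by move: Phi_ge0 PA; apply: ae_inS2 => y Oy ?; rewrite ger0_norm.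
move: PA' Gx; apply: ae_inS2 => y Oy Py Gy.
have a1 : a <= 1 by case/andP: hgamma => _ /(le_trans bg)/(le_trans ab).
have := green_profile_le hNs y (d_gt0 Ox) a0 a1 ab bg.
rewrite -/p => h.
rewrite -EFinM lee_fin normrM.
apply: (@le_trans _ _ ((A * (d x + enorm (x - y)) `^ a) * (c2 * profile x y))).
  apply: ler_pM => //; apply: (le_trans Py); rewrite ler_wpM2l//.
  apply: le_powRr => //; first exact: dist_boundary_ge0.
  by rewrite addrC enormBC; exact: dist_boundary_lip.
apply: (@le_trans _ _ (c2 * A * (profile x y * (d x + enorm (x - y)) `^ a))).
  by rewrite le_eqVlt; apply/orP; left; apply/eqP; ring.
apply: (@le_trans _ _ (c2 * A * (2 * d x `^ b * enorm (x - y) `^ (- p)))).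
  by rewrite ler_wpM2l// mulr_ge0// ltW.
by rewrite le_eqVlt; apply/orP; left; apply/eqP; ring.
Qed.

(** Each step raises the exponent by at most [s], strictly less than the admissible gain [2 * s],
    and caps it at [gamma]; boundedness of [Phi] is the case of exponent 0. *)
Lemma eigenfunction_le M : ae_in Omega (fun x => Phi x <= M) ->
  exists2 A : R, 0 <= A & ae_in Omega (fun x => Phi x <= A * d x `^ gamma).
Proof.
move=> PM.
have H k : exists2 A : R, 0 <= A &
    ae_in Omega (fun x => Phi x <= A * d x `^ (Num.min (k%:R * s) gamma)).
  elim: k => [|k [A A0 HA]].
    exists (Num.max 0 M); first by rewrite le_max lexx.
    move: PM; apply: ae_inS => x Ox PM.
    by rewrite mul0r min_l// powRr0 mulr1 le_max PM orbT.
  apply: (eigenfunction_le_step A0 _ _ _ _ HA).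
  - by rewrite le_min gamma_ge0 mulr_ge0// ltW.
  - by rewrite le_min !ge_min lexx orbT andbT ler_wpM2r ?ler_nat ?(ltW s_gt0).
  - by rewrite ge_min lexx orbT.
  - rewrite -natr1 mulrDl mul1r; case: (leP (k%:R * s) gamma) => k1; rewrite gt_min.
      by rewrite ltrD2l ltr_pMl// ltr1n.
    by rewrite [X in _ || X]ltrDl mulr_gt0// orbT.
pose k := (Num.truncn (gamma / s)).+1.
have [A A0 HA] := H k; exists A => //.
move: HA; rewrite min_r// /k -ler_pdivrMr//.
by apply: ltW; apply: truncnS_gt.
Qed.

End bounds.

(** * Test functions of time *)

Section spline.
Context (R : realType).
Implicit Types t r h e a b : R.

Definition pospart t : R := Num.max 0 t.

(* A C^1 step from 0 to [2 * h ^+ 2] on [0, 2h]; its derivative is [tent h]. *)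
Definition step h t : R :=
  pospart t ^+ 2 - 2 * pospart (t - h) ^+ 2 + pospart (t - 2 * h) ^+ 2.

Definition tent h t : R :=
  2 * pospart t - 4 * pospart (t - h) + 2 * pospart (t - 2 * h).

Lemma pospart_lip t r : `|pospart t - pospart r| <= `|t - r|.
Proof.
rewrite /pospart ler_norml.
have := ler_norm (t - r); have := ler_norm (- (t - r)); have := normr_ge0 (t - r).
rewrite normrN; move: (`|t - r|) => n.
by case: (leP 0 t) => ?; case: (leP 0 r) => ? ? ? ?; apply/andP; split; lra.
Qed.

Lemma sqr_pospart_taylor t e :
  `|pospart (t + e) ^+ 2 - pospart t ^+ 2 - e * (2 * pospart t)| <= e ^+ 2.
Proof.
by rewrite ler_norml /pospart; case: (leP 0 t) => ht; case: (leP 0 (t + e)) => hr;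
  apply/andP; split; nra.
Qed.

(** [step] combines three shifted squares of [pospart], each with Taylor remainder at most [e ^+ 2];
    their weights 1, 2, 1 add up to 4. Similarly the weights 2, 4, 2 give the Lipschitz constant 8
    of [tent]. *)
Lemma step_taylor h t e : `|step h (t + e) - step h t - e * tent h t| <= 4 * e ^+ 2.
Proof.
have := sqr_pospart_taylor (t - 2 * h) e; have := sqr_pospart_taylor (t - h) e.
have := sqr_pospart_taylor t e; rewrite /step /tent.
have -> : t + e - h = t - h + e by ring.
have -> : t + e - 2 * h = t - 2 * h + e by ring.
rewrite !ler_norml => /andP[? ?] /andP[? ?] /andP[? ?]; apply/andP; split; lra.
Qed.

Lemma tent_lip h t r : `|tent h t - tent h r| <= 8 * `|t - r|.
Proof.
have := pospart_lip (t - 2 * h) (r - 2 * h); have := pospart_lip (t - h) (r - h).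
have := pospart_lip t r; rewrite /tent.
have -> : t - h - (r - h) = t - r by ring.
have -> : t - 2 * h - (r - 2 * h) = t - r by ring.
rewrite !ler_norml => /andP[? ?] /andP[? ?] /andP[? ?]; apply/andP; split; lra.
Qed.

Lemma tent_ge0 h t : 0 < h -> 0 <= tent h t.
Proof.
move=> h0; rewrite /tent /pospart.
by case: (leP 0 t) => ?; case: (leP 0 (t - h)) => ?; case: (leP 0 (t - 2 * h)) => ?; lra.
Qed.

Lemma tent_le0 h t : 0 < h -> t <= 0 -> tent h t = 0.
Proof.
move=> h0 t0; rewrite /tent /pospart.
by case: (leP 0 t) => ?; case: (leP 0 (t - h)) => ?; case: (leP 0 (t - 2 * h)) => ?; lra.
Qed.

Lemma tent_ge h t : 0 < h -> 2 * h <= t -> tent h t = 0.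
Proof.
move=> h0 t0; rewrite /tent /pospart.
by case: (leP 0 t) => ?; case: (leP 0 (t - h)) => ?; case: (leP 0 (t - 2 * h)) => ?; lra.
Qed.

Lemma step_le0 h t : 0 < h -> t <= 0 -> step h t = 0.
Proof.
move=> h0 t0; rewrite /step /pospart.
by case: (leP 0 t) => ?; case: (leP 0 (t - h)) => ?; case: (leP 0 (t - 2 * h)) => ?; nra.
Qed.

Lemma step_ge h t : 0 < h -> 2 * h <= t -> step h t = 2 * h ^+ 2.
Proof.
move=> h0 t0; rewrite /step /pospart.
by case: (leP 0 t) => ?; case: (leP 0 (t - h)) => ?; case: (leP 0 (t - 2 * h)) => ?; nra.
Qed.

Lemma step_homo h t r : 0 < h -> t <= r -> step h t <= step h r.
Proof.
move=> h0 tr; rewrite /step /pospart.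
case: (leP 0 t) => ?; case: (leP 0 (t - h)) => ?; case: (leP 0 (t - 2 * h)) => ?;
case: (leP 0 r) => ?; case: (leP 0 (r - h)) => ?; case: (leP 0 (r - 2 * h)) => ?; nra.
Qed.

End spline.

Section taylor.
Context (R : realType).
Implicit Types (F f : R -> R) (t r e K : R).

Lemma lip_continuous f K : (forall t r, `|f t - f r| <= K * `|t - r|) -> continuous f.
Proof.
move=> H t; apply/cvgrPdist_lt => e e0.
have K0 : 0 < `|K| + 1 by rewrite ltr_wpDl.
near=> r; apply: le_lt_trans (H t r) _.
apply: (@le_lt_trans _ _ ((`|K| + 1) * `|t - r|)).
  by rewrite ler_wpM2r// (le_trans (ler_norm K))// lerDl.
rewrite mulrC -ltr_pdivlMr//; near: r.
by apply: cvgr_dist_lt; [exact: cvg_id|exact: divr_gt0].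
Unshelve. all: by end_near. Qed.

Lemma taylor_quotient F f K t e : e != 0 ->
  `|F (t + e) - F t - e * f t| <= K * e ^+ 2 ->
  `|e^-1 * (F (t + e) - F t) - f t| <= K * `|e|.
Proof.
move=> e0 H; have -> : e^-1 * (F (t + e) - F t) - f t =
    e^-1 * (F (t + e) - F t - e * f t) by field.
rewrite normrM normfV ler_pdivrMl ?normr_gt0//; apply: le_trans H _.
by rewrite [leRHS]mulrCA -expr2 real_normK ?num_real.
Qed.

Lemma cvg_norm_dnbhs0 K : K * `|e| @[e --> (0 : R)^'] --> 0.
Proof.
by apply: (@cvg_to_0_linear _ _ `|K| 1) => // r _; rewrite normrM normr_id.
Qed.

Lemma taylor_is_derive F f K t :
  (forall e, `|F (t + e) - F t - e * f t| <= K * e ^+ 2) -> is_derive t 1 F (f t).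
Proof.
move=> H; have cF : e^-1 *: (F (e *: 1 + t) - F t) @[e --> 0^'] --> f t.
  apply/subr_cvg0; apply: (@cvg_to_0_linear _ _ K 1) => // e /andP[e0 _].
  rewrite [e *: 1]mulr1 (addrC e); apply: taylor_quotient => //.
  by rewrite -normr_gt0.
by apply: DeriveDef; [exact: cvgP cF|exact: cvg_lim cF].
Qed.

End taylor.

Section tent_integral.
Context (R : realType).
Implicit Types (t r h a b : R).
Notation lambda := (@lebesgue_measure R).

Lemma continuous_tent h a : continuous (fun t => tent h (t - a)).
Proof.
apply: (@lip_continuous _ _ 8) => t r; rewrite (le_trans (tent_lip _ _ _))//.
by rewrite (_ : t - a - (r - a) = t - r)//; ring.
Qed.

Lemma is_derive_step h a t : is_derive t 1 (fun t => step h (t - a)) (tent h (t - a)).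
Proof.
apply: (@taylor_is_derive _ _ (fun t => tent h (t - a)) 4) => e.
by rewrite (_ : t + e - a = t - a + e); [exact: step_taylor|ring].
Qed.

Lemma integral_tent h a : 0 < h -> 0 <= a ->
  (\int[lambda]_(t in `]0%R, +oo[) (tent h (t - a))%:E = (2 * h ^+ 2)%:E)%E.
Proof.
move=> h0 a0.
transitivity (\int[lambda]_(t in `[a, (a + 2 * h)%R]) (tent h (t - a))%:E)%E.
  rewrite integral_mkcond [RHS]integral_mkcond; apply: eq_integral => t _.
  rewrite !patchE; case: ifPn => t1; case: ifPn => // t2.
  - move: t2; rewrite notin_setE/= in_itv/= => /negP; rewrite negb_and -!ltNge.
    by case/orP => t2; [rewrite tent_le0|rewrite tent_ge] => //; lra.
  - move: t1 t2; rewrite notin_setE inE/= !in_itv/= andbT => /negP; rewrite -leNgt.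
    by move=> t1 /andP[t2 _]; rewrite tent_le0//; lra.
have cs : continuous (fun t => step h (t - a)).
  move=> t; apply/differentiable_continuous/derivable1_diffP.
  exact: (@ex_derive _ _ _ _ _ _ _ (is_derive_step h a t)).
rewrite (@continuous_FTC2 _ _ (fun t => step h (t - a))).
- rewrite /= [step h (a - a)]step_le0 ?subrr// step_ge ?sube0//; lra.
- by rewrite ltrDl mulr_gt0.
- by apply: continuous_subspaceT => t; exact: continuous_tent.
- split=> [t _||].
  + exact: (@ex_derive _ _ _ _ _ _ _ (is_derive_step h a t)).
  + by apply: cvg_at_right_filter; exact: cs.
  + by apply: cvg_at_left_filter; exact: cs.
- by move=> t _; rewrite derive1E (@derive_val _ _ _ _ _ _ _ (is_derive_step h a t)).
Qed.

Lemma integrable_tent h a : 0 < h -> 0 <= a ->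
  lambda.-integrable `]0, +oo[ (EFin \o (fun t => tent h (t - a))).
Proof.
move=> h0 a0; apply/integrableP; split.
  apply/measurable_EFinP; apply: measurable_funTS; apply: continuous_measurable_fun.
  exact: continuous_tent.
under eq_integral do rewrite gee0_abs ?lee_fin ?tent_ge0//.
by rewrite integral_tent// ltry.
Qed.

(** Tents of equal mass just after time 0 and just after [T] approximate multiples of point
    evaluations. If [H T > H 0], continuity makes the tested integral negative. The first tent
    starts at [h > 0] since test functions must vanish near time 0. *)
Lemma nonincreasing_of_weak (H : R -> R) (T : R) : 0 < T ->
  (forall t, 0 <= t -> 0 <= H t) ->
  (forall t, 0 <= t -> forall e : R, 0 < e -> exists2 h : R, 0 < h &
     forall r, 0 <= r -> `|r - t| < h -> `|H r - H t| < e) ->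
  (forall a b h, 0 < a -> a <= b -> 0 < h ->
     0 <= \int[lambda]_(t in `]0, +oo[) ((tent h (t - a) - tent h (t - b)) * H t)) ->
  H T <= H 0.
Proof.
move=> T0 H0 cH weak; rewrite leNgt; apply/negP => HT.
pose e := (H T - H 0) / 3; have e0 : 0 < e by rewrite divr_gt0// subr_gt0.
have [h1 h1_gt0 Hh1] := cH 0 (lexx _) e e0.
have [h2 h2_gt0 Hh2] := cH T (ltW T0) e e0.
(* A quarter of the minimum puts the supports, between [h] and [3 * h] and between [T] and
   [T + 2 * h], inside the two continuity windows, and ensures [h <= T]. *)
pose h := Num.min (Num.min h1 h2) T / 4.
have m0 : 0 < Num.min (Num.min h1 h2) T by rewrite !lt_min h1_gt0 h2_gt0.
have h0 : 0 < h by rewrite divr_gt0.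
have hh1 : 3 * h < h1.
  have : Num.min (Num.min h1 h2) T <= h1 by rewrite !ge_min lexx.
  by rewrite /h; move: m0; move: (Num.min _ _) => m; lra.
have hh2 : 3 * h < h2.
  have : Num.min (Num.min h1 h2) T <= h2 by rewrite !ge_min lexx orbT.
  by rewrite /h; move: m0; move: (Num.min _ _) => m; lra.
have hT : h <= T.
  have : Num.min (Num.min h1 h2) T <= T by rewrite ge_min lexx orbT.
  by rewrite /h; move: m0; move: (Num.min _ _) => m; lra.
have := weak h T h h0 hT h0; apply/negP; rewrite -ltNge.
pose q1 := H 0 + e; pose q2 := H T - e; pose q3 := H T + e.
have q12 : q1 < q2 by rewrite /q1 /q2 /e; lra.
have HT0 := H0 _ (ltW T0).
have near1 t : 0 < t -> tent h (t - h) != 0 -> 0 <= H t <= q1.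
  move=> t0 th; rewrite H0 ?(ltW t0)//=.
  have t1 : h < t by rewrite ltNge; apply: contra th => ?; rewrite tent_le0//; lra.
  have t2 : t < 3 * h by rewrite ltNge; apply: contra th => ?; rewrite tent_ge//; lra.
  have := Hh1 t (ltW t0); rewrite subr0 gtr0_norm// => /(_ (lt_trans t2 hh1)).
  by rewrite ltr_norml => /andP[_]; rewrite /q1; lra.
have near2 t : 0 < t -> tent h (t - T) != 0 -> q2 <= H t <= q3.
  move=> t0 th.
  have t1 : T < t by rewrite ltNge; apply: contra th => ?; rewrite tent_le0//; lra.
  have t2 : t < T + 2 * h by rewrite ltNge; apply: contra th => ?; rewrite tent_ge//; lra.
  have := Hh2 t (ltW t0); rewrite gtr0_norm ?subr_gt0//.
  have -> : t - T < h2 by lra.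
  by move=> /(_ isT); rewrite ltr_norml /q2 /q3 => /andP[? ?]; apply/andP; split; lra.
have mH : measurable_fun (`]0, +oo[ : set R) H.
  apply: open_continuous_measurable_fun => //.
  move=> t; rewrite inE/= in_itv/= andbT => t0; apply/cvgrPdist_lt => e' e'0.
  have [k k0 Hk] := cH t (ltW t0) e' e'0.
  near=> r; rewrite distrC; apply: Hk.
    by apply/ltW; near: r; exact: lt_nbhsr.
  by rewrite distrC; near: r; apply: cvgr_dist_lt => //; exact: cvg_id.
have mt k a : measurable_fun (`]0, +oo[ : set R) (fun t => tent k (t - a)).
  by apply: measurable_funTS; apply: continuous_measurable_fun; exact: continuous_tent.
have p1 := tent_ge0 _ h0.
have i1 := integrable_tent h0 (ltW h0); have i2 := integrable_tent h0 (ltW T0).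
have bound t : 0 < t ->
    [/\ tent h (t - h) * H t <= q1 * tent h (t - h),
        q2 * tent h (t - T) <= tent h (t - T) * H t,
        0 <= tent h (t - h) * H t & tent h (t - T) * H t <= q3 * tent h (t - T)].
  move=> t0; split.
  - have [->|/near1 -/(_ t0)/andP[_ Hq]] := eqVneq (tent h (t - h)) 0.
      by rewrite mul0r mulr0.
    by rewrite mulrC ler_wpM2r.
  - have [->|/near2 -/(_ t0)/andP[Hq _]] := eqVneq (tent h (t - T)) 0.
      by rewrite mul0r mulr0.
    by rewrite [leRHS]mulrC ler_wpM2r.
  - by rewrite mulr_ge0// H0// ltW.
  - have [->|/near2 -/(_ t0)/andP[_ Hq]] := eqVneq (tent h (t - T)) 0.
      by rewrite mul0r mulr0.
    by rewrite mulrC ler_wpM2r.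
(* An integrable majorant: on the support of each tent [H] is bounded, by [q1] and [q3]
   respectively. Comparing real-valued integrals requires integrability. *)
have ig : lambda.-integrable (`]0, +oo[ : set R)
    (EFin \o (fun t => `|q1| * tent h (t - h) + `|q3| * tent h (t - T))).
  rewrite (_ : EFin \o _ = (fun t =>
    `|q1|%:E * (tent h (t - h))%:E + `|q3|%:E * (tent h (t - T))%:E)%E)//.
  by apply: integrableD => //; apply: integrableZl.
apply: (@le_lt_trans _ _ (\int[lambda]_(t in `]0, +oo[)
    (q1 * tent h (t - h) - q2 * tent h (t - T)))).
  apply: le_Rintegral => //.
  - apply: (le_integrable _ _ _ ig) => //.
    + by apply/measurable_EFinP; apply: measurable_funM => //; apply: measurable_funB; exact: mt.
    + move=> t; rewrite /= in_itv/= andbT => t0; rewrite lee_fin.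
      have [b1 b2 b3 b4] := bound _ t0.
      rewrite [leRHS]ger0_norm; last by rewrite addr_ge0// mulr_ge0// p1.
      have n1 := ler_norm q1; have n3 := ler_norm q3.
      have b5 : q1 * tent h (t - h) <= `|q1| * tent h (t - h) by rewrite ler_wpM2r ?p1.
      have b6 : q3 * tent h (t - T) <= `|q3| * tent h (t - T) by rewrite ler_wpM2r ?p1.
      have b7 : 0 <= tent h (t - T) * H t by rewrite mulr_ge0 ?p1 ?H0 ?(ltW t0).
      have b8 : 0 <= `|q1| * tent h (t - h) by rewrite mulr_ge0 ?p1.
      have b9 : 0 <= `|q3| * tent h (t - T) by rewrite mulr_ge0 ?p1.
      by rewrite mulrBl ler_norml; apply/andP; split; lra.
  - rewrite (_ : EFin \o _ = (fun t =>
      q1%:E * (tent h (t - h))%:E - q2%:E * (tent h (t - T))%:E)%E)//.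
    by apply: integrableB => //; apply: integrableZl.
  - move=> t; rewrite /= in_itv/= andbT => t0; have [b1 b2 _ _] := bound _ t0.
    by rewrite mulrBl lerB.
rewrite RintegralB//; last 2 first.
- rewrite (_ : EFin \o _ = (fun t => (q1%:E * (tent h (t - h))%:E)%E))//.
  exact: integrableZl.
- rewrite (_ : EFin \o _ = (fun t => (q2%:E * (tent h (t - T))%:E)%E))//.
  exact: integrableZl.
rewrite !RintegralZl// /Rintegral !integral_tent ?(ltW h0) ?(ltW T0)//=.
by rewrite subr_lt0 ltr_pM2r// mulr_gt0// exprn_gt0.
Unshelve. all: by end_near. Qed.

End tent_integral.

Section test_functions.
Context (R : realType) (N : nat) (Omega : set 'rV[R]_N).
Notation mu := (lebesgue_rV R N).
Hypothesis mO : measurable Omega.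

(** An essential supremum over a null space would be [-oo]; here the whole space has positive
    measure. This is the lower side of the squeeze arguments below. *)
Lemma Linfnorm_ge0 (f : 'rV[R]_N -> R) : (0 <= Linfnorm Omega f)%E.
Proof.
apply: ess_sup_gee.
  by apply: lebesgue_open_gt0; [exact: openT|exists 0].
by apply: nearW => x; rewrite lee_fin mulr_ge0.
Qed.

Lemma Linfnorm_le (f : 'rV[R]_N -> R) C : (forall x, `|f x| <= C) ->
  (Linfnorm Omega f <= C%:E)%E.
Proof.
move=> fC; apply/ess_supP; apply: nearW => x; rewrite lee_fin.
by rewrite indicE; case: (x \in Omega); rewrite ?mulr1// mulr0 (le_trans _ (fC x)).
Qed.

(** Since [|g| <= 1], every required limit in the sup norm reduces to a scalar bound on [theta] or
    [dtheta]. *)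
Lemma C1c_Linf_tensor (theta dtheta : R -> R) (g : 'rV[R]_N -> R) (K a b : R) :
  measurable_fun Omega g -> (forall x, `|g x| <= 1) ->
  (forall t e, `|theta (t + e) - theta t - e * dtheta t| <= K * e ^+ 2) ->
  (forall t r, `|dtheta t - dtheta r| <= K * `|t - r|) ->
  0 < a -> (forall t, t \notin `[a, b] -> theta t = 0) ->
  C1c_Linf Omega (fun t x => theta t * g x) (fun t x => dtheta t * g x).
Proof.
move=> mg g1 ht hd a0 hab.
have ctheta : continuous theta.
  move=> t; apply/differentiable_continuous/derivable1_diffP.
  exact: (@ex_derive _ _ _ _ _ _ _ (taylor_is_derive (ht t))).
have mtens (f : R -> R) : continuous f ->
    measurable_fun ((`]0, +oo[ : set R) `*` Omega) (fun z => f z.1 * g z.2).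
  move=> cf; apply: measurable_funM.
    apply: measurable_funTS; apply: (measurableT_comp _ measurable_fst).
    exact: continuous_measurable_fun.
  change (measurable_fun ((`]0, +oo[ : set R) `*` Omega) (g \o snd)).
  apply: (measurable_comp (F := Omega)) => //.
    by move=> _ [[x y] [/= _ Oy] <-].
  by apply: measurable_funTS; exact: measurable_snd.
have bnd (c : R) x : `|c * g x| <= `|c| by rewrite normrM ler_piMr.
split.
- by split; apply: mtens => //; exact: lip_continuous hd.
- by move=> t _; split; apply: le_lt_trans (Linfnorm_le (bnd _)) _; rewrite ltry.
- move=> t t0.
  apply: (@squeeze_cvge _ _ _ _ (cst 0%E) _ (fun e => (K * `|e|)%:E)).
  + near=> e; rewrite Linfnorm_ge0/=; apply: Linfnorm_le => x /=.
    have e0 : e != 0 by near: e; exact: nbhs_dnbhs_neq.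
    rewrite -[X in `|X|]/(e^-1 * (theta (t + e) * g x - theta t * g x) - dtheta t * g x).
    rewrite -mulrBl mulrA -mulrBl normrM.
    by rewrite (le_trans _ (taylor_quotient e0 (ht t e)))// ler_piMr.
  + exact: cvg_cst.
  + apply: cvg_EFin; first exact: nearW.
    exact: cvg_norm_dnbhs0.
- move=> t t0.
  apply: (@squeeze_cvge _ _ _ _ (cst 0%E) _ (fun r => (K * `|r - t|)%:E)).
  + near=> r; rewrite Linfnorm_ge0/=; apply: Linfnorm_le => x /=.
    rewrite -[X in `|X|]/(dtheta r * g x - dtheta t * g x) -mulrBl normrM.
    by rewrite (le_trans _ (hd r t))// ler_piMr.
  + exact: cvg_cst.
  + apply: cvg_EFin; first exact: nearW.
    rewrite [X in _ --> X](_ : 0 = K * `|t - t|); last by rewrite subrr normr0 mulr0.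
    apply: (@cvgM _ _ _ _ (cst K) (fun r : R => `|r - t|)); first exact: cvg_cst.
    by apply: cvg_norm; apply: cvgB; [exact: cvg_id|exact: cvg_cst].
- exists a, b; split => // t _ tab; apply: nearW => x _.
  by rewrite hab// mul0r.
Unshelve. all: by end_near. Qed.

End test_functions.

(** * Monotonicity along the evolution *)

Section evolution.
Context (R : realType) (N : nat) (Omega : set 'rV[R]_N)
  (G : 'rV[R]_N -> 'rV[R]_N -> R).
Notation mu := (lebesgue_rV R N).
Notation lambda := (@lebesgue_measure R).
Notation potential := (potential Omega G).
Notation pairing := (pairing Omega G).
Implicit Types f g h : 'rV[R]_N -> R.
Hypothesis mO : measurable Omega.
Hypothesis mG : measurable_fun (Omega `*` Omega) (fun z => G z.1 z.2).
Hypothesis G_ge0 : ae_in Omega (fun x => ae_in Omega (fun y => 0 <= G x y)).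

(** Measurability of parametrized integrals is available for nonnegative integrands, so the signed
    integral is split into its positive and negative parts. *)
Lemma measurable_green_op f : measurable_fun Omega f ->
  measurable_fun Omega (green_op Omega G f).
Proof.
move=> mf.
have mfG : measurable_fun (Omega `*` Omega) (fun z => (f z.2 * G z.1 z.2)%:E).
  apply/measurable_EFinP; apply: measurable_funM => //.
  exact: measurable_fun_snd.
have mfGN : measurable_fun (Omega `*` Omega) (fun z => (- (f z.2 * G z.1 z.2))%:E).
  by apply/measurable_EFinP; apply: measurableT_comp => //; exact/measurable_EFinP.
have -> : green_op Omega G f = fun x => fine
    (\int[mu]_(y in Omega) maxe (f y * G x y)%:E 0 -
     \int[mu]_(y in Omega) maxe (- (f y * G x y)%:E) 0)%E.
  apply/funext => x; rewrite /green_op /Rintegral [in LHS]integralE.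
  by congr (fine (_ - _)); apply: eq_integral => y _; rewrite ?funeposE ?funenegE.
apply: (measurableT_comp (fine_measurable measurableT)) => //.
apply: emeasurable_funB.
- apply: (@measurable_integral_in _ _ _ _ _ mu _ _ mO mO
    (fun x y => maxe (f y * G x y)%:E 0)%E) => [|x y].
    exact: measurable_maxe mfG (measurable_cst _).
  by rewrite le_max lexx orbT.
- apply: (@measurable_integral_in _ _ _ _ _ mu _ _ mO mO
    (fun x y => maxe (- (f y * G x y)%:E) 0)%E) => [|x y].
    exact: measurable_maxe mfGN (measurable_cst _).
  by rewrite le_max lexx orbT.
Qed.

(** Finiteness of the pairing makes [potential f] finite almost everywhere on [g != 0], where it
    then agrees with [green_op]; where [g] vanishes, both integrands are 0. *)
Lemma green_op_pairing f g (c : R) : measurable_fun Omega f -> measurable_fun Omega g ->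
  ae_in Omega (fun x => 0 <= f x) -> ae_in Omega (fun x => 0 <= g x) ->
  (pairing f g < +oo)%E ->
  \int[mu]_(x in Omega) (green_op Omega G f x * (c * g x)) = c * fine (pairing f g).
Proof.
move=> mf mg f0 g0 fin.
have mp : measurable_fun Omega (fun x => potential f x * `|g x|%:E)%E.
  apply: emeasurable_funM; first exact: measurable_potential.
  by apply/measurable_EFinP; exact: measurableT_comp.
have p0 x : (0 <= potential f x * `|g x|%:E)%E by rewrite mule_ge0// potential_ge0.
have ip : mu.-integrable Omega (fun x => potential f x * `|g x|%:E)%E.
  apply/integrableP; split => //.
  by under eq_integral do rewrite gee0_abs//.
have fp : pairing f g \is a fin_num by rewrite ge0_fin_numE// integral_ge0.
have -> : c * fine (pairing f g) = fine (c%:E * pairing f g)%E by rewrite fineM.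
rewrite /pairing -integralZl//; congr fine.
apply: ae_eq_integral => //.
- apply/measurable_EFinP; apply: measurable_funM; first exact: measurable_green_op.
  exact: measurable_funM.
- exact: measurable_funeM.
have H : ae_in Omega (fun x => (potential f x * `|g x|%:E)%E \is a fin_num).
  exact: integrable_ae ip.
have H2 : ae_in Omega (fun x => 0 <= g x /\ (potential f x * `|g x|%:E)%E \is a fin_num).
  by move: g0 H; apply: ae_inS2.
move: G_ge0 H2; apply: ae_inS2 => x Ox Gx [gx].
have [->|gx0] := eqVneq (g x) 0; first by rewrite !mulr0 normr0 !mule0.
rewrite ger0_norm// => pf.
have gp : 0 < g x by rewrite lt_neqAle eq_sym gx0.
have pfin : potential f x \is a fin_num.
  rewrite ge0_fin_numE ?potential_ge0// ltNge leye_eq; apply/negP => /eqP px.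
  by move: pf; rewrite px gt0_mulye ?lte_fin.
have mGx := measurable_kernel1 mO mG Ox.
have -> : green_op Omega G f x = fine (potential f x).
  rewrite /green_op /Rintegral; congr fine; apply: ae_eq_integral => //.
  - by apply/measurable_EFinP; exact: measurable_funM.
  - by apply/measurable_EFinP; apply: measurableT_comp => //; exact: measurable_funM.
  - by move: f0 Gx; apply: ae_inS2 => y _ ? ?; rewrite ger0_norm// mulr_ge0.
by rewrite -[in RHS](fineK pfin) -!EFinM mulrCA.
Qed.

Context (Phi : 'rV[R]_N -> R) (F : R -> R) (u0 : 'rV[R]_N -> R)
  (u : R -> 'rV[R]_N -> R) (K : R).
Hypothesis mPhi : measurable_fun Omega Phi.
Hypothesis Phi_ge0 : ae_in Omega (fun x => 0 <= Phi x).
Hypotheses (cF : continuous F) (F_homo : {homo F : x y / x <= y}) (F0 : F 0 = 0).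
Hypothesis hu : weak_dual_solution Omega G F Phi u0 u.
Hypothesis u_ge0 : forall t, 0 <= t -> ae_in Omega (fun x => 0 <= u t x).
Hypothesis K_ge0 : 0 <= K.
Hypothesis pairing_le : forall f g, measurable_fun Omega f -> measurable_fun Omega g ->
  ae_in Omega (fun x => `|g x| <= Phi x) ->
  (pairing f g <= K%:E * wL1norm Omega Phi f)%E.
Hypothesis pairing_lip : forall f h g, measurable_fun Omega f -> measurable_fun Omega h ->
  measurable_fun Omega g -> ae_in Omega (fun x => `|g x| <= Phi x) ->
  (pairing f g <= pairing h g + K%:E * wL1norm Omega Phi (f - h)%R)%E.

(** With a time factor times [w] as test function, the weak equation equates the integral of the
    tent difference times the pairing with an integral of [F(u) psi], which is nonnegative. The
    bounds on [pairing] supply finiteness and continuity in time. *)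
Lemma pairing_nonincreasing (A : set 'rV[R]_N) (T : R) : 0 < T -> measurable A ->
  (forall x, A x -> Phi x != 0) ->
  (pairing (u T) (fun x => \1_A x * Phi x)%R <= pairing (u 0) (fun x => \1_A x * Phi x)%R)%E.
Proof.
move=> T0 mA APhi; set w := fun x => _.
have mI : measurable_fun Omega (\1_A : 'rV[R]_N -> R).
  by apply: measurable_funTS; exact: measurable_indic.
have mw : measurable_fun Omega w by exact: measurable_funM.
have mu_ t : 0 <= t -> measurable_fun Omega (u t) by move=> /(wds_wL1 hu)[].
have w0 : ae_in Omega (fun x => 0 <= w x).
  by move: Phi_ge0; apply: ae_inS => x _ P0; rewrite mulr_ge0.
have wPhi : ae_in Omega (fun x => `|w x| <= Phi x).
  move: Phi_ge0; apply: ae_inS => x _ P0; rewrite /w normrM (ger0_norm P0).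
  by rewrite ler_piMl// indicE; case: (_ \in _); rewrite ?normr1 ?normr0.
have fin t : 0 <= t -> (pairing (u t) w < +oo)%E.
  move=> t0; apply: le_lt_trans (pairing_le (mu_ _ t0) mw wPhi) _.
  by apply: lte_mul_pinfty => //; have [] := wds_wL1 hu t0.
have p0 t : (0 <= pairing (u t) w)%E.
  by apply: integral_ge0 => x _; rewrite mule_ge0// potential_ge0.
have pfin t : 0 <= t -> pairing (u t) w \is a fin_num.
  by move=> t0; rewrite ge0_fin_numE// fin.
have [H HE] : exists H : R -> R, forall t, 0 <= t -> pairing (u t) w = (H t)%:E.
  by exists (fun t => fine (pairing (u t) w)) => t t0; rewrite fineK// pfin.
rewrite (HE _ (ltW T0)) (HE _ (lexx 0)) lee_fin.
have normC t r : wL1norm Omega Phi (u t - u r) = wL1norm Omega Phi (u r - u t).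
  by apply: eq_integral => x _; rewrite [X in `|X|](_ : _ = - (u r - u t) x) ?normrN// opprB.
apply: nonincreasing_of_weak => //.
- by move=> t t0; rewrite -lee_fin -HE.
- move=> t t0 e e0.
  have K1 : 0 < K + 1 by rewrite ltr_wpDl.
  have := wds_cont hu t0.
  move=> /fine_cvgP[+ /cvgrPdist_lt /(_ (e / (K + 1)))].
  rewrite divr_gt0// => + /(_ isT).
  rewrite !near_withinE => n1 n2.
  have [d /= d0 Hd] := (@nbhs_ballP R R t _).1 (filterI n1 n2).
  exists d => // r r0 rt.
  have [] := Hd r; first by rewrite /ball/= distrC.
  have rI : r \in `[0, +oo[ by rewrite in_itv/= r0.
  move=> /(_ rI) Wfin /(_ rI); rewrite sub0r normrN => We.
  set W := wL1norm _ _ _ in Wfin We.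
  have We' : K * fine W < e.
    apply: (@le_lt_trans _ _ ((K + 1) * `|fine W|)); last by rewrite mulrC -ltr_pdivlMr.
    apply: (@le_trans _ _ (K * `|fine W|)); first by rewrite ler_wpM2l// ler_norm.
    by rewrite ler_wpM2r// lerDl.
  have h1 := pairing_lip (mu_ _ r0) (mu_ _ t0) mw wPhi.
  have h2 := pairing_lip (mu_ _ t0) (mu_ _ r0) mw wPhi.
  have WE : wL1norm Omega Phi (u r - u t)%R = W by [].
  rewrite WE in h1; rewrite normC WE in h2.
  move: Wfin We We' h1 h2; rewrite !HE//; case: W {WE} => // W _ _.
  rewrite -!EFinM -!EFinD !lee_fin /= => We' h1 h2.
  by rewrite ltr_norml; apply/andP; split; move: h1 h2 We'; lra.
- move=> a b h a0 ab h0.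
  have test : C1c_Linf Omega
      (fun t x => (step h (t - a) - step h (t - b)) * w x / Phi x)
      (fun t x => (tent h (t - a) - tent h (t - b)) * w x / Phi x).
    (* Since [A] avoids the zeros of [Phi], the quotient is a bounded indicator everywhere, which
       makes the test function admissible. *)
    have wE x : w x / Phi x = \1_A x.
      rewrite /w indicE; have [/set_mem Ax|nA] := boolP (x \in A); last by rewrite !mul0r.
      by rewrite mul1r mulfV// APhi.
    under [X in C1c_Linf _ X _]eq_fun do under eq_fun do rewrite -mulrA wE.
    under [X in C1c_Linf _ _ X]eq_fun do under eq_fun do rewrite -mulrA wE.
    (* The constant 16 is the Lipschitz bound for two tents. Before [a] both steps vanish, and after
       [b + 2 * h] both equal [2 * h ^+ 2], so their difference has compact support. *)
    apply: (@C1c_Linf_tensor _ _ _ _ (fun t => step h (t - a) - step h (t - b))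
      (fun t => tent h (t - a) - tent h (t - b)) _ 16 a (b + 2 * h)) => //.
    - by move=> x; rewrite indicE; case: (_ \in _); rewrite ?normr1 ?normr0.
    - move=> t e; have := step_taylor h (t - a) e; have := step_taylor h (t - b) e.
      have -> : t - a + e = t + e - a by ring.
      have -> : t - b + e = t + e - b by ring.
      have := sqr_ge0 e.
      move: (e ^+ 2) => e2 e20; rewrite !ler_norml => /andP[? ?] /andP[? ?].
      by apply/andP; split; lra.
    - move=> t r; have := tent_lip h (t - a) (r - a); have := tent_lip h (t - b) (r - b).
      have -> : t - a - (r - a) = t - r by ring.
      have -> : t - b - (r - b) = t - r by ring.
      move: (`|t - r|) => e; rewrite !ler_norml => /andP[? ?] /andP[? ?].
      by apply/andP; split; lra.
    - move=> t; rewrite in_itv/= negb_and -!ltNge => /orP[|] tab.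
        by rewrite !step_le0 ?subrr// subr_le0 ltW// (lt_le_trans tab).
      by rewrite !step_ge ?subrr//; lra.
  have weak := wds_eq hu test.
  apply: (@le_trans _ _ (\int[lambda]_(t in `]0, +oo[) \int[mu]_(x in Omega)
      (F (u t x) * ((step h (t - a) - step h (t - b)) * w x)))); last first.
    rewrite -weak le_eqVlt; apply/orP; left; apply/eqP; apply: eq_Rintegral => t.
    rewrite inE/= in_itv/= andbT => /ltW t0.
    have := green_op_pairing (tent h (t - a) - tent h (t - b))
      (mu_ _ t0) mw (u_ge0 t0) w0 (fin _ t0).
    by rewrite (HE _ t0).
  clear weak test; apply: Rintegral_ge0 => t; rewrite /= in_itv/= andbT => t_gt0.
  have t0 := ltW t_gt0.
  have th0 : 0 <= step h (t - a) - step h (t - b).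
    by rewrite subr_ge0; apply: step_homo => //; rewrite lerD2l lerN2.
  move: (step h (t - a) - step h (t - b)) th0 => c c0.
  have mFu : measurable_fun Omega (F \o u t).
    by apply: measurableT_comp; [exact: continuous_measurable_fun|exact: mu_].
  have mFw : measurable_fun Omega (fun x => F (u t x) * (c * w x)).
    by apply: measurable_funM => //; exact: measurable_funM.
  apply: fine_ge0.
  have -> : (\int[mu]_(x in Omega) (F (u t x) * (c * w x))%:E =
      \int[mu]_(x in Omega) `|F (u t x) * (c * w x)|%:E)%E.
    apply: ae_eq_integral => //.
    - exact/measurable_EFinP.
    - by apply/measurable_EFinP; exact: measurableT_comp.
    - move: (u_ge0 t0) w0; apply: ae_inS2 => x Ox ux wx.
      have Fu : 0 <= F (u t x) by have := F_homo ux; rewrite F0.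
      by rewrite ger0_norm// mulr_ge0// mulr_ge0.
  by apply: integral_ge0 => x _; rewrite lee_fin.
Qed.

End evolution.

(** * Comparison of the two potentials in a thin boundary layer *)

Section contradiction.
Context (R : realType) (N : nat) (Omega : set 'rV[R]_N)
  (G : 'rV[R]_N -> 'rV[R]_N -> R).
Notation mu := (lebesgue_rV R N).
Notation potential := (potential Omega G).
Notation pairing := (pairing Omega G).
Notation d := (dist_boundary Omega).
Hypotheses (bO : bounded_domain Omega) (N0 : (0 < N)%N).
Hypothesis mG : measurable_fun (Omega `*` Omega) (fun z => G z.1 z.2).
Hypothesis G_ge0 : ae_in Omega (fun x => ae_in Omega (fun y => 0 <= G x y)).

Let oO : open Omega. Proof. by case: bO. Qed.
Let mO : measurable Omega. Proof. exact: open_measurable_rV. Qed.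
Let B0 : boundary Omega !=set0. Proof. exact: boundary_neq0. Qed.

Lemma le_potential (f g : 'rV[R]_N -> R) (c : R) : 0 <= c ->
  measurable_fun Omega f -> measurable_fun Omega g ->
  ae_in Omega (fun y => 0 <= f y) -> ae_in Omega (fun y => f y <= c * g y) ->
  forall x, Omega x -> (potential f x <= c%:E * potential g x)%E.
Proof.
move=> c0 mf mg f0 fg x Ox.
have mGx := measurable_kernel1 mO mG Ox.
have m (h : 'rV[R]_N -> R) : measurable_fun Omega h ->
    measurable_fun Omega (fun y => `|h y * G x y|%:E).
  move=> mh; apply/measurable_EFinP; apply: measurableT_comp => //.
  exact: measurable_funM.
rewrite -ge0_integralZl_EFin//; last exact: m.
apply: ae_ge0_le_integral => //.
- exact: m.
- by move=> y _; rewrite -EFinM lee_fin mulr_ge0.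
- by apply: measurable_funeM; exact: m.
move: f0 fg; apply: ae_inS2 => y Oy f0 fg.
rewrite -EFinM lee_fin !normrM mulrA ler_wpM2r// ger0_norm//.
by rewrite (le_trans fg)// ler_wpM2l// ler_norm.
Qed.

(* Testing [potential v <= potential v0] against [Phi] on a thin boundary layer
   is enough: there the two bounds on the potentials are incompatible. *)
Lemma boundary_layer_exponent (Phi v v0 : 'rV[R]_N -> R) (cPhi CPhi c C kappa gamma : R) :
  measurable_fun Omega Phi -> measurable_fun Omega v -> measurable_fun Omega v0 ->
  0 < cPhi -> ae_in Omega (fun x => cPhi * d x `^ gamma <= Phi x) ->
  0 <= CPhi -> ae_in Omega (fun x => Phi x <= CPhi * d x `^ gamma) ->
  0 < c -> ae_in Omega (fun x => (c * d x `^ kappa)%:E <= potential v x)%E ->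
  0 <= C -> ae_in Omega (fun x => potential v0 x <= (C * Phi x)%:E)%E ->
  (forall A, measurable A -> (forall x, A x -> Phi x != 0) ->
    (pairing v (fun x => \1_A x * Phi x)%R <=
     pairing v0 (fun x => \1_A x * Phi x)%R < +oo)%E) ->
  gamma <= kappa.
Proof.
move=> mPhi mv mv0 cPhi0 PhiL CPhi0 PhiU c0 vL C0 v0U test.
rewrite leNgt; apply/negP => kg.
pose q := c / (CPhi + 1).
have CP1 : 0 < CPhi + 1 by rewrite ltr_wpDl.
have q0 : 0 < q by rewrite divr_gt0.
pose eta := gamma - kappa; have eta0 : 0 < eta by rewrite subr_gt0.
(* Where [d x < eps], the lower bound satisfies [c d^kappa = c d^gamma d^(- eta) >= q Phi eps^(-
   eta) = (C + 1) Phi], which beats the upper bound [C Phi]. The [+ 1] in [q] only avoids a division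
   by zero. *)
pose eps := (q / (C + 1)) `^ eta^-1.
have C1 : 0 < C + 1 by rewrite ltr_wpDl.
have eps0 : 0 < eps by rewrite powR_gt0// divr_gt0.
have epsE : q * eps `^ (- eta) = C + 1.
  rewrite /eps -powRrM mulrN mulVf ?gt_eqF// powR_inv1 ?divr_ge0 ?ltW//.
  by rewrite invf_div mulrC -mulrA mulVf ?mulr1// gt_eqF.
pose O := Omega `&` [set x | d x < eps].
have oOO : open O.
  apply: openI => //; rewrite openE => x /= dx; apply/nbhs_enormP.
  exists (eps - d x); first by rewrite subr_gt0.
  move=> y xy /=; apply: le_lt_trans (dist_boundary_lip B0 y x) _.
  by rewrite enormBC -ltrBrDr.
have O0 : O !=set0 by have [x Ox dx] := dist_boundary_small B0 eps0; exists x.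
(* Removing the zeros of [Phi] makes [A] admissible for [test] and changes the layer by a null set
   only. *)
pose A := Omega `&` (Phi @^-1` [set~ 0]) `&` O.
have mA : measurable A.
  apply: measurableI; last exact: open_measurable_rV.
  by apply: mPhi => //; exact: measurableC.
have AP x : A x -> Phi x != 0 by move=> [[_ /eqP]].
pose w x := \1_A x * Phi x.
have mw : measurable_fun Omega w.
  by apply: measurable_funM => //; apply: measurable_funTS; exact: measurable_indic.
have Phi0 : ae_in Omega (fun x => 0 < Phi x).
  move: PhiL; apply: ae_inS => x Ox; apply: lt_le_trans.
  by rewrite mulr_gt0// powR_gt0// dist_boundary_gt0.
have /andP[h1 h2] := test A mA AP; rewrite -/w in h1 h2.
(* On [A] the weight is [Phi] itself, so bounding a potential by a multiple of [Phi] bounds its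
   pairing by the same multiple of [S]. *)
pose S := (\int[mu]_(x in Omega) (w x ^+ 2)%:E)%E.
have mw2 : measurable_fun Omega (fun x => (w x ^+ 2)%:E).
  by apply/measurable_EFinP; exact: measurable_funX.
have S0 : (0 <= S)%E by apply: integral_ge0 => x _; rewrite lee_fin sqr_ge0.
have mpw (f : 'rV[R]_N -> R) : measurable_fun Omega f ->
    measurable_fun Omega (fun x => potential f x * `|w x|%:E)%E.
  move=> mf; apply: emeasurable_funM; first exact: measurable_potential.
  by apply/measurable_EFinP; exact: measurableT_comp.
have pw0 f x : (0 <= potential f x * `|w x|%:E)%E by rewrite mule_ge0// potential_ge0.
have wcase x : w x = 0 \/ (A x /\ w x = Phi x).
  rewrite /w indicE; have [/set_mem Ax|_] := boolP (x \in A); last by left; rewrite mul0r.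
  by right; rewrite mul1r.
have up : (pairing v0 w <= C%:E * S)%E.
  rewrite -(ge0_integralZl_EFin mu mO _ mw2 C0); last first.
    by move=> x _; rewrite lee_fin sqr_ge0.
  apply: ae_ge0_le_integral => //.
  - exact: mpw.
  - by move=> x _; rewrite -EFinM lee_fin mulr_ge0// sqr_ge0.
  - exact: measurable_funeM.
  move: Phi0 v0U; apply: ae_inS2 => x Ox P0 vx.
  have [->|[Ax ->]] := wcase x; first by rewrite normr0 mule0 expr0n mule0.
  rewrite gtr0_norm// expr2 -EFinM mulrA EFinM; apply: lee_wpmul2r => //.
  by rewrite lee_fin ltW.
have low : ((C + 1)%:E * S <= pairing v w)%E.
  rewrite -(ge0_integralZl_EFin mu mO _ mw2 (ltW C1)); last first.
    by move=> x _; rewrite lee_fin sqr_ge0.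
  apply: ae_ge0_le_integral => //.
  - by move=> x _; rewrite -EFinM lee_fin mulr_ge0 ?sqr_ge0// ltW.
  - exact: measurable_funeM.
  - exact: mpw.
  have PP : ae_in Omega (fun x => 0 < Phi x /\ Phi x <= CPhi * d x `^ gamma).
    by move: Phi0 PhiU; apply: ae_inS2.
  move: PP vL; apply: ae_inS2 => x Ox [P0 PU] vx.
  have [->|[Ax ->]] := wcase x; first by rewrite normr0 mule0 expr0n mule0.
  rewrite gtr0_norm// expr2 -EFinM mulrA EFinM; apply: lee_wpmul2r; first by rewrite lee_fin ltW.
  apply: le_trans vx; rewrite lee_fin.
  have dx0 : 0 < d x by exact: dist_boundary_gt0.
  have dxe : d x < eps by case: Ax => _ [].
  have -> : d x `^ kappa = d x `^ gamma * d x `^ (- eta).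
    rewrite -powRD; last by rewrite (gt_eqF dx0) implybT.
    by congr (_ `^ _); rewrite /eta; ring.
  have e1 : eps `^ (- eta) <= d x `^ (- eta) by apply: le_powRN => //; exact: ltW.
  have qP : q * Phi x <= c * d x `^ gamma.
    rewrite /q mulrAC ler_pdivrMr// -mulrA ler_pM2l//.
    by rewrite (le_trans PU)// mulrC ler_wpM2l ?powR_ge0// lerDl ler01.
  rewrite -epsE; apply: (@le_trans _ _ (c * d x `^ gamma * eps `^ (- eta))).
    by rewrite mulrAC ler_wpM2r ?powR_ge0.
  by rewrite -mulrA ler_pM2l// ler_wpM2l ?powR_ge0.
(* Finiteness of [S], inherited from the pairing with [v0], is what allows cancelling in
   [(C + 1) S <= C S]. *)
have Sfin : S \is a fin_num.
  rewrite ge0_fin_numE//; rewrite ltNge leye_eq; apply/negP => /eqP Soo.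
  have := le_lt_trans (le_trans low h1) h2.
  by rewrite Soo gt0_muley ?lte_fin.
have S00 : S = 0%E.
  have := le_trans low (le_trans h1 up); rewrite -(fineK Sfin) -!EFinM lee_fin.
  rewrite mulrDl mul1r gerDl => h; congr EFin; apply/eqP; rewrite eq_le h.
  exact: fine_ge0.
have wz : ae_in Omega (fun x => w x = 0).
  have [+ _] := @ae_eq_integral_abs _ _ _ mu _ mO _ mw2.
  under eq_integral do rewrite gee0_abs ?lee_fin ?sqr_ge0//.
  move=> /(_ S00); apply: filterS => x h Ox.
  by have /eqP := h Ox; rewrite eqe sqrf_eq0 => /eqP.
have : ae_in Omega (fun x => ~ O x).
  move: Phi0 wz; apply: ae_inS2 => x Ox P0 w0 Oxx.
  have Ax : A x by split => //; split => //=; apply/eqP; rewrite gt_eqF.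
  by move: w0; rewrite /w indicE mem_set// mul1r => /eqP; rewrite gt_eqF.
move=> [B [mB B00 OB]].
have := lebesgue_open_gt0 oOO O0; rewrite lt_neqAle => /andP[/eqP + _]; apply.
apply/esym/(subset_measure0 _ mB _ B00); first exact: open_measurable_rV.
by move=> x Ox; apply: OB => /= h; apply: h => //; case: Ox.
Qed.

End contradiction.

Theorem theorem5p14 (R : realType) (N : nat) (s gamma : R)
  (Omega : set 'rV[R]_N)
  (D : set ('rV[R]_N -> R)) (L : ('rV[R]_N -> R) -> ('rV[R]_N -> R))
  (G : 'rV[R]_N -> 'rV[R]_N -> R) (lambda1 : R) (Phi1 : 'rV[R]_N -> R)
  (F : R -> R) (mu0 mu1 : R)
  (u0 : 'rV[R]_N -> R) (u : R -> 'rV[R]_N -> R) (C0 k14 T alpha : R)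
  (hs : 0 < s <= 1) (hgamma : 0 < gamma <= 1)
  (hN : (1 <= N)%N) (hNs : 2 * s < N%:R)
  (hOmega : bounded_domain Omega) (hC11 : C11_boundary Omega)
  (hL : densely_defined_linear Omega D L)
  (hG : green_left_inverse Omega D L G)
  (hPhi1 : first_eigenpair Omega D L lambda1 Phi1)
  (hF : nonlinearity F mu0 mu1)
  (hacc : m_accretive Omega D L) (hsub : sub_Markovian Omega D L)
  (hbounds : green_bounds Omega s gamma G)
  (hu0 : wL1 Omega Phi1 u0) (hu0_ge0 : ae_in Omega (fun x => 0 <= u0 x))
  (hu : weak_dual_solution Omega G F Phi1 u0 u)
  (hu_ge0 : forall t, 0 <= t -> ae_in Omega (fun x => 0 <= u t x))
  (hC0 : 0 < C0) (hu0_le : ae_in Omega (fun x => u0 x <= C0 * Phi1 x))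
  (hk14 : 0 < k14) (hT : 0 < T) (halpha : 0 < alpha)
  (hlower : ae_in Omega (fun x => k14 * Phi1 x `^ alpha <= u T x)) :
  1 - 2 * s / gamma <= alpha /\
  (sigma_of s gamma mu1 < 1 -> (m_of mu1)^-1 < alpha).
Proof.
have [c1 [c2 [c10 c20 hb]]] := hbounds.
have [lam0 [DPhi Phi_neq0 LPhi] _ Phi_ge0 [M PhiM]] := hPhi1.
have [[cF F_homo F0] _] := hF.
have /andP[s_gt0 _] := hs; have /andP[gamma_gt0 _] := hgamma.
have mO : measurable Omega by apply: open_measurable_rV; case: hOmega.
have mG := green_measurable hG.
have mPhi : measurable_fun Omega Phi1.
  by have /integrableP[/measurable_EFinP] := dom_L1 hL DPhi.
have G_ge0 := green_ae_ge0 c10 hb.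
have potPhi := potential_eigenfunction mO hL hG G_ge0 lam0 DPhi LPhi Phi_ge0.
have [cPhi cPhi0 PhiL] :=
  eigenfunction_ge hOmega hN mG c10 hNs hgamma hb lam0 mPhi Phi_neq0 potPhi.
have [CPhi CPhi0 PhiU] :=
  eigenfunction_le hOmega hN mG c10 c20 s_gt0 hNs hgamma hb lam0 mPhi Phi_ge0 potPhi PhiM.
have mu_ t : 0 <= t -> measurable_fun Omega (u t) by move=> /(wds_wL1 hu)[].
have u0E : eqae Omega (u 0) u0 by have [] := wds_init hu.
have alpha_ge : gamma <= 2 * s + gamma * alpha.
  have [|||c c0 vL] := @potential_ge R N Omega G s gamma c1 c2 hOmega hN mG c10 hNs hgamma hb
      (u T) (k14 * cPhi `^ alpha) (gamma * alpha) (mu_ _ (ltW hT)).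
  - by rewrite mulr_gt0 ?powR_gt0.
  - by rewrite mulr_ge0 ?ltW.
  - move: PhiL hlower; apply: ae_inS2 => y Oy PL; apply: le_trans.
    rewrite powRrM -mulrA ler_pM2l// -powRM ?powR_ge0 ?(ltW cPhi0)//.
    by apply: le_powRr => //; [exact: ltW|rewrite mulr_ge0 ?powR_ge0 ?ltW].
  have K0 : 0 <= c2 / (c1 * lambda1) by rewrite divr_ge0 ?mulr_ge0 ?ltW.
  have pair_le := pairing_le mO mG c10 c20 hb lam0 mPhi Phi_ge0 potPhi.
  apply: (boundary_layer_exponent hOmega hN mG mPhi (mu_ _ (ltW hT)) (mu_ _ (lexx 0))
    cPhi0 PhiL CPhi0 PhiU c0 vL (C := C0 / lambda1)).
  - by rewrite divr_ge0 ?ltW.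
  - have u0_le : ae_in Omega (fun y => u 0 y <= C0 * Phi1 y).
      by move: u0E hu0_le; apply: ae_inS2 => y _ ->.
    move: potPhi; apply: ae_inS => x Ox Px.
    have := le_potential hOmega mG (ltW hC0) (mu_ _ (lexx 0)) mPhi (hu_ge0 _ (lexx 0)) u0_le Ox.
    by rewrite Px -EFinM mulrCA mulrC mulrAC.
  - move=> A mA AP; apply/andP; split.
      have pair_lip := pairing_lip mO mG c10 c20 hb lam0 mPhi Phi_ge0 potPhi.
      exact: (pairing_nonincreasing mO mG G_ge0 mPhi Phi_ge0 cF F_homo F0 hu hu_ge0 K0
        pair_le pair_lip hT mA AP).
    apply: le_lt_trans (pair_le _ _ (mu_ _ (lexx 0)) _ _) _.
    + by apply: measurable_funM => //; apply: measurable_funTS; exact: measurable_indic.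
    + move: Phi_ge0; apply: ae_inS => x _ P0; rewrite normrM (ger0_norm P0).
      by rewrite ler_piMl// indicE; case: (_ \in _); rewrite ?normr1 ?normr0.
    + by apply: lte_mul_pinfty => //; have [] := wds_wL1 hu (lexx 0).
have concl : 1 - 2 * s / gamma <= alpha.
  by rewrite lerBlDr -(ler_pM2l gamma_gt0) mulr1 mulrDr mulrCA mulfV ?gt_eqF// mulr1 addrC.
split => // sigma_lt1; apply: lt_le_trans concl.
have [_ [_ [/andP[mu0_gt0 mu01] mu1_lt1]]] := hF.
have mu1_gt0 := lt_le_trans mu0_gt0 mu01.
have m0 : 0 < 1 - mu1 by rewrite subr_gt0.
move: sigma_lt1; rewrite /sigma_of /m_of gt_min ltxx/= invrK.
(* Here [m_1 / (m_1 - 1) = 1 / mu1] and [1 / m_1 = 1 - mu1], so [sigma_1 < 1] says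
   [2 s / gamma < mu1], and the strict inequality is inherited. *)
have -> : 2 * s * (1 - mu1)^-1 / (gamma * ((1 - mu1)^-1 - 1)) = 2 * s / gamma / mu1.
  have -> : (1 - mu1)^-1 - 1 = mu1 / (1 - mu1) by field; rewrite gt_eqF.
  by field; rewrite !gt_eqF.
by rewrite ltr_pdivrMr// mul1r ltrD2l ltrN2.
Qed.
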